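(* Let $n>1$ and $d>1$ be integers and let $K$ be an algebraically closed field. The projective variety $X_{d,n}=V(I_{d,n})\subset\mathbb{P}^{n(d+1)-1}$ is irreducible of dimension $\dim X_{d,n}=nd$ and degree $\deg X_{d,n}=nd$.
   Context: The $a_{i,j}$ ($1\le i\le n$, $0\le j\le d$) are independent indeterminates over $K$, which are the homogeneous coordinates of $\mathbb{P}^{n(d+1)-1}$ over $K$. Put $f_i(x)=a_{i,0}x^d+a_{i,1}x^{d-1}+\cdots+a_{i,d}$ for $1\le i\le n$. The resultant ideal is $I_{d,n}=\langle f_1,\dots,f_n\rangle\cap K[a_{i,j}]$, where $\langle f_1,\dots,f_n\rangle\subset K[a_{i,j}][x]$; it is a radical ideal. Equivalently, $X_{d,n}$ is the locus of coefficients for which the binary forms $g_i(x,y)=a_{i,0}x^d+a_{i,1}x^{d-1}y+\cdots+a_{i,d}y^d$ have a common root in $\mathbb{P}^1$. *)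

(* Defs.v *)
From HB Require Import structures.
From mathcomp Require Import all_boot all_order all_algebra.
From mathcomp Require Export mpoly.

Set Implicit Arguments.
Unset Strict Implicit.
Unset Printing Implicit Defensive.

Import GRing.Theory.
Local Open Scope ring_scope.

Section ProjectiveSpace.
Variables (K : closedFieldType) (N : nat).

(* P^N over K: the lines through the origin of K^(N+1). *)
Definition proj_space : Type := {L : {vspace 'rV[K]_N.+1} | \dim L == 1%N}.

Definition pset : Type := proj_space -> Prop.

Definition psubset (X Y : pset) : Prop := forall L, X L -> Y L.

(* Vanishing on the whole line L: for a homogeneous p this is the usual
   condition on one representative, and as K is infinite, for an arbitrary p it
   says that every homogeneous component of p vanishes at L.  In particular a
   nonzero constant vanishes nowhere. *)
Definition vanishes_at (p : {mpoly K[N.+1]}) (L : proj_space) : Prop :=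
  forall v : 'rV[K]_N.+1, v \in val L -> p.@[v 0] = 0.

Definition zero_locus (T : {mpoly K[N.+1]} -> Prop) : pset :=
  fun L => forall p, T p -> vanishes_at p L.

(* The homogeneous ideal I(X): see the remark on vanishes_at. *)
Definition vanishing_ideal (X : pset) : {mpoly K[N.+1]} -> Prop :=
  fun p => forall L, X L -> vanishes_at p L.

Definition zariski_closed (X : pset) : Prop :=
  exists T : {mpoly K[N.+1]} -> Prop,
    (forall p, T p -> exists m, p \is m.-homog)
    /\ (forall L, X L <-> zero_locus T L).

Definition irreducible (X : pset) : Prop :=
  (exists L, X L)
  /\ (forall A B : pset, zariski_closed A -> zariski_closed B ->
        (forall L, X L -> A L \/ B L) -> psubset X A \/ psubset X B).

(* Z 0 < Z 1 < ... < Z r; the values of Z beyond r are irrelevant. *)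
Definition irreducible_chain (X : pset) (r : nat) (Z : nat -> pset) : Prop :=
  (forall i, (i <= r)%N ->
     [/\ zariski_closed (Z i), irreducible (Z i) & psubset (Z i) X])
  /\ (forall i, (i < r)%N ->
        psubset (Z i) (Z i.+1) /\ ~ psubset (Z i.+1) (Z i)).

(* Krull dimension of a Zariski closed set X. *)
Definition has_dim (X : pset) (r : nat) : Prop :=
  (exists Z, irreducible_chain X r Z)
  /\ (forall s Z, irreducible_chain X s Z -> (s <= r)%N).

(* h is the dimension of the degree m part of the homogeneous coordinate ring
   K[x_0, ..., x_N] / I(X); U is the degree m part of I(X). *)
Definition hilbert_value (X : pset) (m h : nat) : Prop :=
  exists U : {vspace dhomog N.+1 K m},
    (forall p : dhomog N.+1 K m, p \in U <-> vanishing_ideal X (val p))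
    /\ h = (\dim {: dhomog N.+1 K m} - \dim U)%N.

Definition hilbert_polynomial (X : pset) (P : {poly rat}) : Prop :=
  exists m0 : nat, forall m, (m0 <= m)%N ->
    exists2 h : nat, hilbert_value X m h & P.[m%:R] = h%:R.

Definition has_degree (X : pset) (e : nat) : Prop :=
  exists r (P : {poly rat}),
    [/\ has_dim X r, hilbert_polynomial X P & r`!%:R * lead_coef P = e%:R].

End ProjectiveSpace.

Section Resultant.
Variables (K : closedFieldType) (d n : nat).

(* a_{i,j} is the coordinate number i(d+1)+j, counting from 0 (and with i in
   {0, ..., n-1} instead of {1, ..., n}); this is always within range. *)
Definition indet (i : 'I_n) (j : 'I_d.+1) : {mpoly K[(n * d.+1).-1.+1]} :=
  'X_(inord (i * d.+1 + j)).

Definition generic_poly (i : 'I_n) : {poly {mpoly K[(n * d.+1).-1.+1]}} :=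
  \sum_(j < d.+1) (indet i j)%:P * 'X^(d - j).

Definition resultant_ideal (p : {mpoly K[(n * d.+1).-1.+1]}) : Prop :=
  exists h : 'I_n -> {poly {mpoly K[(n * d.+1).-1.+1]}},
    p%:P = \sum_(i < n) h i * generic_poly i.

Definition resultant_variety : pset K (n * d.+1).-1 :=
  zero_locus resultant_ideal.

End Resultant.

Arguments resultant_variety K d n : clear implicits.

(* Main.v *)
(* Substituting for f_1, ..., f_n the products (x - t) q_i identifies the resultant
   ideal with the kernel of Psi : K[a] -> K[q][t], so that it is the whole vanishing
   ideal of X and is prime and homogeneous: the quotient of f_i by x - t is given by
   Horner's scheme, and setting t = x in it changes only the constant terms
   a_{i,d}, into a_{i,d} - f_i.

   Existence of a Hilbert polynomial: the Hilbert function counts the monomials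
   that are not leading monomials of the vanishing ideal, and these form a down-set.

   As Psi maps degree m to bidegree (m, <= m) in (q, t), the Hilbert function is at
   most (m + 1) C(m + nd - 1, nd - 1). Conversely the Sylvester matrix of f_1 and
   f_2, one row removed, has a kernel vector over K[a] that yields P0, P1 with
   Psi(P1) = t Psi(P0) != 0; multiplication by Psi(P0)^(d-1) then sends every
   polynomial of degree k in q and degree < k + d in t into the image of Psi.
   The two bounds have the same leading term m^(nd) / (nd - 1)!, whence the degree.

   For the dimension, a chain Z_0 < ... < Z_s of irreducible closed subsets gives
   forms f_0, ..., f_s of equal degree, f_i vanishing on Z_{i-1} but not on Z_i; they
   are algebraically independent modulo I(X), so the upper bound forces s <= nd.
   A chain of length nd consists of linear subspaces of {t = 0}, followed by X. *)

From HB Require Import structures.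
Require Import Defs.
From mathcomp Require Import all_boot all_order all_algebra.
From mathcomp Require Import perm.
From mathcomp Require Import zify ring lra.
From Stdlib Require Import Classical ClassicalEpsilon.

Set Implicit Arguments.
Unset Strict Implicit.
Unset Printing Implicit Defensive.

Import Order.TTheory GRing.Theory Num.Theory.
Local Open Scope ring_scope.

(** * Counting points of down-sets *)

Definition eventually_poly (c : nat -> nat) : Prop :=
  exists (P : {poly rat}) m0, forall m, (m0 <= m)%N -> P.[m%:R] = (c m)%:R.

(** The difference of ['X^(n.+1)] has degree [n] and leading coefficient [n.+1], so a multiple of it
    cancels the top coefficient of [Q] and lowers the size. *)
Lemma antidifference (Q : {poly rat}) : exists T, T \Po ('X + 1) - T = Q.
Proof.
have [n] := ubnP (size Q); elim: n Q => // n IH Q; rewrite ltnS => szQ.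
case: n IH szQ => [|n] IH szQ.
  by exists 0; move: szQ; rewrite comp_poly0 subrr leqn0 size_poly_eq0 => /eqP ->.
pose a : rat := Q`_n / n.+1%:R.
have XD1 : ('X + 1 : {poly rat}) ^+ n.+1 = \poly_(i < n.+2) ('C(n.+1, i)%:R).
  rewrite addrC exprDn poly_def; apply: eq_bigr => i _.
  by rewrite expr1n mul1r -scaler_nat.
pose D := a *: (('X + 1) ^+ n.+1 - 'X^(n.+1)) : {poly rat}.
have [|T TQ] := IH (Q - D).
  rewrite ltnS; apply/leq_sizeP => j lenj.
  rewrite coefB coefZ coefB XD1 coef_poly coefXn.
  move: lenj; rewrite leq_eqVlt => /orP[/eqP <-|ltnj].
    rewrite ltnW // binSn [n == _]ltn_eqF // subr0 divfK ?subrr //.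
    by rewrite pnatr_eq0.
  have -> : Q`_j = 0 by apply: nth_default; apply: leq_trans szQ _.
  move: ltnj; rewrite leq_eqVlt => /orP[/eqP <-|ltnj].
    by rewrite eqxx ltnSn binn subrr mulr0 subr0.
  by rewrite ltnNge ltnj [j == _]gtn_eqF //= subrr mulr0 subr0.
exists (T + a *: 'X^(n.+1)).
rewrite comp_polyD comp_polyZ comp_Xn_poly opprD addrACA TQ -scalerBr.
by rewrite -/D subrK.
Qed.

Lemma eventually_poly_sum c :
  eventually_poly c -> eventually_poly (fun m => \sum_(j < m) c j)%N.
Proof.
move=> [Q [m0 Qc]]; have [T TQ] := antidifference Q.
(* [e] makes both sides agree at [m0]; from there on their increments agree. *)
pose e : rat := (\sum_(j < m0) c j)%:R - T.[m0%:R].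
exists (T + e%:P), m0 => m /subnKC <-; rewrite hornerD hornerC.
elim: (m - m0)%N => [|k IH]; first by rewrite addn0 /e addrC subrK.
rewrite addnS big_ord_recr natrD -IH /= -Qc ?leq_addr // -TQ.
rewrite hornerD hornerN horner_comp hornerD hornerX -polyC1 hornerC natr1.
by rewrite [RHS]addrC [RHS]addrA subrK.
Qed.

Lemma eventually_polyD c1 c2 : eventually_poly c1 -> eventually_poly c2 ->
  eventually_poly (fun m => c1 m + c2 m)%N.
Proof.
move=> [P1 [m1 H1]] [P2 [m2 H2]]; exists (P1 + P2), (maxn m1 m2) => m.
by rewrite geq_max => /andP[le1 le2]; rewrite hornerD H1 // H2 // natrD.
Qed.

Lemma eventually_poly_shift c a :
  eventually_poly c -> eventually_poly (fun m => c (m - a)%N).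
Proof.
move=> [P [m0 H]]; exists (P \Po ('X - a%:R%:P)), (m0 + a)%N => m lem.
rewrite horner_comp !hornerE -natrB ?H //; lia.
Qed.

Lemma eventually_poly_eq c1 c2 m0 : (forall m, (m0 <= m)%N -> c1 m = c2 m) ->
  eventually_poly c1 -> eventually_poly c2.
Proof.
move=> E [P [m1 H]]; exists P, (maxn m0 m1) => m.
by rewrite geq_max => /andP[le1 le2]; rewrite H // E.
Qed.

Lemma eventually_poly_bigsum J (c : nat -> nat -> nat) :
  (forall a, eventually_poly (c a)) ->
  eventually_poly (fun m => \sum_(a < J) c a m)%N.
Proof.
move=> H; elim: J => [|J IH].
  by exists 0, 0%N => m _; rewrite big_ord0 horner0.
apply: (eventually_poly_eq (m0 := 0)) (eventually_polyD IH (H J)) => m _.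
by rewrite big_ord_recr.
Qed.

(** These are the exponent vectors of the monomials of degree [m] in [k] variables, as plain lists,
    so that fixing the first exponent is a [cons]. *)
Fixpoint compositions (k m : nat) : seq (seq nat) :=
  if k is k'.+1 then
    flatten [seq [seq j :: s | s <- compositions k' (m - j)] | j <- iota 0 m.+1]
  else if m == 0%N then [:: [::]] else [::].

Definition down_set (k : nat) (D : pred (seq nat)) : Prop :=
  forall s t, size s = k -> size t = k -> all2 leq s t -> D t -> D s.

Lemma down_set_slice k D a :
  down_set k.+1 D -> down_set k (fun s => D (a :: s)).
Proof.
move=> dD s t szs szt le Dt; apply: (dD _ (a :: t)) => //=.
- by rewrite szs.
- by rewrite szt.
by rewrite leqnn.
Qed.

(* Dickson's lemma: for the first exponent [a] and the index [j] both large,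
   the slices agree with the stable diagonal slice; only finitely many [a]
   remain. *)
Lemma down_sets_stabilize k (D : nat -> pred (seq nat)) :
  (forall j, down_set k (D j)) ->
  (forall i j s, (i <= j)%N -> size s = k -> D j s -> D i s) ->
  exists J, forall j s, (J <= j)%N -> size s = k -> D j s = D J s.
Proof.
elim: k D => [|k IH] D dD decD.
  have [[J DJ]|noJ] := classic (exists J, ~~ D J [::]).
    exists J => j s lej /size0nil ->; rewrite (negPf DJ).
    by apply: contraNF DJ; apply: decD.
  exists 0%N => j s _ /size0nil ->.
  have H i : D i [::] by apply/negPn/negP => h; apply: noJ; exists i.
  by rewrite !H.
have le_slice a b j s : (a <= b)%N -> size s = k -> D j (b :: s) -> D j (a :: s).
  move=> leab szs; apply: (dD j) => //=; rewrite ?szs // leab /=.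
  by elim: s {szs} => //= x s ->; rewrite leqnn.
have [||J HJ] := IH (fun j s => D j (j :: s)).
- by move=> j; apply: down_set_slice.
- move=> i j s leij szs /(decD i j) h.
  by apply: (le_slice _ _ _ _ leij) => //; apply: h => //=; rewrite szs.
have HJ2 a j s : (J <= a)%N -> (J <= j)%N -> size s = k ->
    D j (a :: s) = D J (J :: s).
  move=> leJa leJj szs; apply/idP/idP => [Dja|].
    by apply: (le_slice _ a) => //; apply: (decD _ j) => //=; rewrite szs.
  rewrite -(HJ (maxn a j)) ?leq_max ?leJa // => Dm.
  apply: (le_slice _ (maxn a j)); rewrite ?leq_maxl //.
  by apply: (decD _ (maxn a j)); rewrite ?leq_maxr //= szs.
have fin b : exists J', forall a j s, (a < b)%N -> (J' <= j)%N ->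
    size s = k -> D j (a :: s) = D J' (a :: s).
  elim: b => [|b [J' HJ']]; first by exists 0%N.
  have [||Jb HJb] := IH (fun j s => D j (b :: s)).
  - by move=> j; apply: down_set_slice.
  - by move=> i j s leij szs; apply: decD => //=; rewrite szs.
  exists (maxn J' Jb) => a j s; rewrite ltnS geq_max leq_eqVlt.
  move=> /orP[/eqP ->|ltab] /andP[le1 le2] szs.
    by rewrite HJb // [RHS]HJb // leq_maxr.
  by rewrite HJ' // [RHS]HJ' // leq_maxl.
have [J' HJ'] := fin J.
exists (maxn J J') => j s; rewrite geq_max => /andP[le1 le2].
case: s => //= a s [szs]; have [ltaJ|leJa] := ltnP a J.
  by rewrite HJ' // [RHS]HJ' // leq_maxr.
by rewrite HJ2 // [RHS]HJ2 // leq_maxl.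
Qed.

Lemma count_compositionsS k m (D : pred (seq nat)) :
  count D (compositions k.+1 m) =
  (\sum_(j < m.+1) count (fun s => D (nat_of_ord j :: s)) (compositions k (m - j)))%N.
Proof.
have -> : compositions k.+1 m = flatten
    [seq [seq j :: s | s <- compositions k (m - j)] | j <- iota 0 m.+1] by [].
rewrite count_flatten -map_comp sumnE big_map -[m.+1]subn0 -/(index_iota _ _).
rewrite big_mkord subn0; apply: eq_bigr => j _ /=.
by rewrite count_map.
Qed.

Lemma size_compositions k m s : s \in compositions k m -> size s = k.
Proof.
elim: k m s => [|k IH] m s; first by rewrite /=; case: eqP => // _; rewrite inE => /eqP ->.
move=> /flattenP[l /mapP[j _ ->] /mapP[t /IH <- ->]] //.
Qed.

(** Sort by the first exponent [a]. The finitely many slices with [a < J] are eventually polynomial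
    by induction; all later ones equal the slice at [J], so together they contribute a partial sum
    of one eventually polynomial function. *)
Lemma eventually_poly_down_set k D : down_set k D ->
  eventually_poly (fun m => count D (compositions k m)).
Proof.
elim: k D => [|k IH] D dD.
  by exists 0, 1%N => m; rewrite horner0 /= => h; rewrite gtn_eqF.
have [||J HJ] := @down_sets_stabilize k (fun a s => D (a :: s)).
- by move=> a; apply: down_set_slice.
- move=> i j s leij szs; apply: dD => /=; rewrite ?szs // leij /=.
  by elim: s {szs} => //= x s ->; rewrite leqnn.
pose c a m := count (fun s => D (a :: s)) (compositions k m).
have cP a : eventually_poly (c a) by apply: IH; apply: down_set_slice.
have P1 : eventually_poly (fun m => \sum_(a < J) c a (m - a)%N)%N.
  apply: (@eventually_poly_bigsum J (fun a m => c a (m - a)%N)) => a.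
  exact: eventually_poly_shift.
have P2 : eventually_poly (fun m => \sum_(j < m.+1) c J j)%N.
  have P' := eventually_polyD (eventually_poly_sum (cP J)) (cP J).
  apply: (eventually_poly_eq (m0 := 0)) P' => m _.
  by rewrite big_ord_recr.
have P3 := eventually_poly_shift J P2.
apply: (eventually_poly_eq (m0 := J)) (eventually_polyD P1 P3) => m leJm.
rewrite count_compositionsS -!(big_mkord xpredT (fun j => c j (m - j)%N)).
rewrite [RHS](big_cat_nat (n := J)) //=; last exact: leq_trans leJm _.
congr addn; rewrite -[X in (\sum_(X <= _ < _) _)%N]add0n big_addn subSn // big_mkord.
(* The degree left after a first exponent [j + J] is [(m - J) - j], so the partial sum is run
   backwards. *)
rewrite (reindex_inj rev_ord_inj) /=; apply: eq_bigr => j _.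
have ltj := ltn_ord j; rewrite /c.
have -> : (m - (j + J) = (m - J) - j)%N by lia.
apply: eq_in_count => s /size_compositions szs.
by rewrite HJ // leq_addl.
Qed.

(** * Asymptotics *)

(** Horner induction: where [p] is at least [e], the polynomial [p * 'X + c] is at least [1] once
    the argument also exceeds (1 + |c|) / e. *)
Lemma poly_eventually_ge (p : {poly rat}) : 0 < lead_coef p ->
  exists e m0, 0 < e /\ forall m, (m0 <= m)%N -> e <= p.[m%:R].
Proof.
elim/poly_ind: p => [|p c IH]; first by rewrite lead_coef0 ltxx.
have [->|nz_p] := eqVneq p 0.
  rewrite mul0r add0r lead_coefC => c0; exists c, 0%N; split=> // m _.
  by rewrite hornerC.
have szp : (size c%:P < size (p * 'X)%R)%N.
  by rewrite size_mulX // (leq_ltn_trans (size_polyC_leq1 _)) // ltnS size_poly_gt0.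
rewrite lead_coefDl // lead_coefMX => /IH[e [m0 [e0 H]]].
pose m1 := Num.bound ((1 + `|c|) / e).
exists 1, (maxn m0 m1); split=> // m; rewrite geq_max => /andP[le0 le1].
rewrite hornerMXaddC.
have h1 : e * m%:R <= p.[m%:R] * m%:R by apply: ler_wpM2r; rewrite ?H ?ler0n.
have h2 : (1 + `|c|) / e <= m%:R.
  apply: le_trans (ltW (archi_boundP _)) _; last by rewrite ler_nat.
  by rewrite divr_ge0 ?addr_ge0 // ltW.
have h3 : - c <= `|c| by rewrite -normrN ler_norm.
rewrite ler_pdivrMr // mulrC in h2; lra.
Qed.

Lemma lead_coef_eventually_ge0 (p : {poly rat}) m0 :
  (forall m, (m0 <= m)%N -> 0 <= p.[m%:R]) -> 0 <= lead_coef p.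
Proof.
move=> H; rewrite leNgt; apply/negP => neg.
have [|e [m1 [e0 H1]]] := @poly_eventually_ge (- p).
  by rewrite lead_coefN oppr_gt0.
have := H1 _ (leq_maxr m0 m1); have := H _ (leq_maxl m0 m1).
by rewrite hornerN; lra.
Qed.

(** If the size dropped, the two leading terms would cancel; nonnegative coefficients with sum 0
    vanish, which contradicts that [a] is nonzero. *)
Lemma size_leq_add_lead_ge0 (a b : {poly rat}) :
  0 <= lead_coef a -> 0 <= lead_coef b -> (size a <= size (a + b)%R)%N.
Proof.
move=> la lb; rewrite leqNgt; apply/negP => lt.
have sz_eq : size b = size a.
  by rewrite -{1}[b](addKr a) size_polyDl size_polyN.
have lsum : lead_coef a + lead_coef b = 0.
  rewrite /lead_coef sz_eq -coefD nth_default //.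
  by move: lt; case: (size a).
have la0 : lead_coef a != 0.
  by rewrite lead_coef_eq0 -size_poly_eq0; move: lt; case: (size a).
have : lead_coef a = 0 by lra.
by move/eqP; rewrite (negPf la0).
Qed.

(** [U - P] and [P - L] have nonnegative leading coefficients, so the degree of [U - P] is at most
    that of their sum [U - L], hence below that of [U]. *)
Lemma lead_coef_squeeze (P L U : {poly rat}) m0 :
  U != 0 -> size L = size U -> lead_coef L = lead_coef U ->
  (forall m, (m0 <= m)%N -> L.[m%:R] <= P.[m%:R] <= U.[m%:R]) ->
  lead_coef P = lead_coef U.
Proof.
move=> nzU szL lcL H.
have lUP : 0 <= lead_coef (U - P).
  apply: (@lead_coef_eventually_ge0 _ m0) => m /H /andP[_].
  by rewrite hornerD hornerN subr_ge0.
have lPL : 0 <= lead_coef (P - L).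
  apply: (@lead_coef_eventually_ge0 _ m0) => m /H /andP[+ _].
  by rewrite hornerD hornerN subr_ge0.
have := size_leq_add_lead_ge0 lUP lPL; rewrite addrA subrK => le.
have ltUL : (size (U - L)%R < size U)%N.
  move: nzU; rewrite -size_poly_gt0; case E : (size U) => [|s] // _.
  rewrite ltnS; apply/leq_sizeP => j; rewrite coefB leq_eqVlt => /orP[/eqP <-|ltj].
    by move: lcL; rewrite /lead_coef szL E /= => ->; rewrite subrr.
  by rewrite !nth_default ?subrr // ?szL E.
have -> : P = U - (U - P) by rewrite subKr.
by rewrite lead_coefDl // size_polyN (leq_ltn_trans le).
Qed.

Lemma binomial_prodE k r :
  ('C(k + r, r))%:R = (r`!%:R)^-1 * \prod_(i < r) (k%:R + i.+1%:R) :> rat.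
Proof.
apply: (mulfI (x := r`!%:R)); first by rewrite pnatr_eq0 -lt0n fact_gt0.
rewrite mulVKf ?pnatr_eq0 -?lt0n ?fact_gt0 // -natrM mulnC bin_ffact ffact_prod.
rewrite natr_prod (reindex_inj rev_ord_inj) /=; apply: eq_bigr => i _.
by rewrite -natrD; congr _%:R; have := ltn_ord i; lia.
Qed.

(** Both bounds on the Hilbert function have this shape: one linear factor counts powers of t, the
    other [r] factors come from a binomial coefficient. *)
Lemma size_lead_prodXaddC r (u : 'I_r -> rat) c v : c != 0 ->
  let p := c *: (('X + v%:P) * \prod_(i < r) ('X + (u i)%:P)) in
  size p = r.+2 /\ lead_coef p = c.
Proof.
move=> c0 /=.
have E : ('X + v%:P) * \prod_(i < r) ('X + (u i)%:P) =
    \prod_(i < r.+1) ('X - (if unlift ord0 i is Some j then - u j else - v)%:P).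
  rewrite big_ord_recl unlift_none polyCN opprK; congr *%R.
  by apply: eq_bigr => i _; rewrite liftK polyCN opprK.
have mon : \prod_(i < r.+1) ('X - (if unlift ord0 i is Some j then - u j else - v)%:P) \is monic.
  by apply: monic_prod => i _; apply: monicXsubC.
by rewrite E size_scale // lead_coefZ (monicP mon) mulr1 size_prod_XsubC
  /index_enum -enumT size_enum_ord.
Qed.

(** Written in m = k + s, both bounds are polynomials with leading term m^(r+1) / r!, and (r+1)! /
    r! = r + 1. *)
Lemma lead_coef_binomial_squeeze (P : {poly rat}) (h : nat -> nat) r e s a m0 :
  (forall m, (m0 <= m)%N -> P.[m%:R] = (h m)%:R) ->
  (forall m, (h m <= m.+1 * 'C(m + r, r))%N) ->
  (forall k, ((k + e) * 'C(k + r, r) <= h (k + s))%N) ->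
  a = r.+1 -> a`!%:R * lead_coef P = a%:R.
Proof.
move=> HP Hu Hl ->.
have c0 : (r`!%:R)^-1 != 0 :> rat by rewrite invr_eq0 pnatr_eq0 -lt0n fact_gt0.
pose U := (r`!%:R)^-1 *: (('X + 1%:P) * \prod_(i < r) ('X + (i.+1%:R : rat)%:P)).
pose L := (r`!%:R)^-1 *: (('X + (e%:R - s%:R)%:P) * \prod_(i < r) ('X + (i.+1%:R - s%:R : rat)%:P)).
have [szU lcU] := size_lead_prodXaddC (fun i : 'I_r => i.+1%:R) 1 c0.
have [szL lcL] := size_lead_prodXaddC (fun i : 'I_r => i.+1%:R - s%:R) (e%:R - s%:R) c0.
rewrite (@lead_coef_squeeze P L U (maxn m0 s)).
- rewrite lcU factS natrM mulfK // pnatr_eq0 -lt0n; exact: fact_gt0.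
- by rewrite -size_poly_gt0 szU.
- by rewrite szL szU.
- by rewrite lcL lcU.
move=> m; rewrite geq_max => /andP[le0 /subnKC le1]; rewrite HP //.
rewrite -le1 addnC; set k := (m - s)%N; apply/andP; split.
  apply: (@le_trans _ _ ((k + e) * 'C(k + r, r))%N%:R); last by rewrite ler_nat.
  rewrite natrM binomial_prodE /L hornerZ hornerM horner_prod [leRHS]mulrCA !natrD.
  rewrite le_eqVlt; apply/orP; left; apply/eqP.
  congr (_ * _); congr (_ * _); first by rewrite hornerD hornerX hornerC; ring.
  by apply: eq_bigr => i _; rewrite hornerD hornerX hornerC; ring.
apply: (@le_trans _ _ ((k + s).+1 * 'C(k + s + r, r))%N%:R); first by rewrite ler_nat.
rewrite natrM binomial_prodE /U hornerZ hornerM horner_prod [leRHS]mulrCA.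
rewrite hornerD hornerX hornerC natr1.
have -> : \prod_(i < r) (('X + (i.+1%:R)%:P) : {poly rat}).[(k + s)%:R] =
    \prod_(i < r) ((k + s)%:R + i.+1%:R).
  by apply: eq_bigr => i _; rewrite hornerD hornerX hornerC.
by rewrite lexx.
Qed.

(** The left side grows like k^s, the right side like k^(r+1). For s > r + 1, cancelling powers of k
    + 1 would bound k + 1 by the constant [c]. *)
Lemma binomial_growth s r E :
  (forall k, ('C(k + s, s) <= (k * E).+1 * 'C(k * E + r, r))%N) -> (s <= r.+1)%N.
Proof.
move=> H; rewrite leqNgt; apply/negP => lt.
have lo k j : (k.+1 ^ j <= 'C(k + j, j) * j`!)%N.
  rewrite bin_ffact; elim: j => [|j IH]; first by rewrite expn0 ffactn0.
  by rewrite addnS ffactSS expnS leq_mul // ltnS leq_addr.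
have up m j : ('C(m + j, j) <= (m + j) ^ j)%N.
  apply: (@leq_trans ('C(m + j, j) * j`!)); first by rewrite leq_pmulr ?fact_gt0.
  rewrite bin_ffact ffact_prod -[X in (_ <= _ ^ X)%N]card_ord -prod_nat_const.
  by apply: leq_prod => i _; rewrite leq_subr.
pose c := (s`! * (E + r.+1) ^ r.+1)%N.
have {}H k : (k.+1 ^ s <= c * k.+1 ^ r.+1)%N.
  apply: leq_trans (lo k s) _; rewrite mulnC /c -mulnA leq_mul2l; apply/orP; right.
  apply: leq_trans (H k) _; rewrite -expnMn [in leqRHS]expnS leq_mul //; first by nia.
  apply: leq_trans (up _ _) _.
  by have [->|r0] := posnP r; rewrite ?expn0 // leq_exp2r //; nia.
have {}H k : (k.+1 <= c)%N.
  have := H k; rewrite -(subnK lt) expnD [X in (_ * X)%N]expnS mulnA.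
  rewrite leq_pmul2r ?expn_gt0 //; apply: leq_trans.
  by rewrite leq_pmull ?expn_gt0.
by have := H c; rewrite ltnn.
Qed.

(** * Hilbert functions and leading monomials *)

(** [P] is an arbitrary proposition, so the subspace is built classically: while a vector of [P] is
    missing it is adjoined, and the codimension drops. *)
Lemma vspace_of_linear_predicate (F : fieldType) (V : vectType F) (P : V -> Prop) :
  P 0 -> (forall a u v, P u -> P v -> P (a *: u + v)) ->
  exists U : {vspace V}, forall v, v \in U <-> P v.
Proof.
move=> P0 Plin.
have H k (U : {vspace V}) : (\dim {:V} - \dim U <= k)%N -> (forall v, v \in U -> P v) ->
    exists U : {vspace V}, forall v, v \in U <-> P v.
  elim: k U => [|k IH] U ledim UP.
    exists U => v; split=> [/UP //|_].
    suff /eqP -> : U == fullv by exact: memvf.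
    by rewrite eqEdim subvf -subn_eq0 -leqn0.
  have [[v [Pv vU]]|noV] := classic (exists v, P v /\ v \notin U); last first.
    exists U => v; split=> [|Pv]; first exact: UP.
    by apply/negPn/negP => vU; apply: noV; exists v.
  apply: (IH (<[v]> + U)%VS).
    suff : (\dim U < \dim (<[v]> + U))%N by lia.
    rewrite ltnNge; apply: contra vU => le; rewrite memvE.
    by have /eqP -> : U == (<[v]> + U)%VS; rewrite ?addvSl // eqEdim addvSr.
  move=> w /memv_addP[_ /vlineP[a ->] [u uU ->]]; apply: Plin => //; exact: UP.
apply: (H _ 0%VS (leqnn _)) => v; rewrite memv0 => /eqP -> //.
Qed.

Lemma exists_seq_max d (T : orderType d) (s : seq T) : s != [::] ->
  exists2 x, x \in s & forall y, y \in s -> (y <= x)%O.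
Proof.
elim: s => // x s IH _; have [->|/IH[y ys ymax]] := eqVneq s [::].
  by exists x => [|y]; rewrite inE // => /eqP ->.
have [lexy|ltyx] := leP x y.
  by exists y; rewrite ?inE ?ys ?orbT // => z; rewrite inE => /predU1P[-> //|/ymax].
exists x; rewrite ?mem_head // => z; rewrite inE => /predU1P[-> //|/ymax /le_trans].
by apply; apply: ltW.
Qed.

(** At the largest exponent with a nonzero coefficient only its own term contributes. *)
Lemma mlead_free (F : fieldType) n (s : seq 'X_{1..n}) (f : 'X_{1..n} -> {mpoly F[n]})
    (c : 'X_{1..n} -> F) :
  uniq s -> {in s, forall a, f a != 0 /\ mlead (f a) = a} ->
  \sum_(a <- s) c a *: f a = 0 -> {in s, forall a, c a = 0}.
Proof.
move=> us fs sum0 a sa; apply/eqP/negPn/negP => ca.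
have [|b] := @exists_seq_max _ _ [seq x <- s | c x != 0].
  by rewrite -has_filter; apply/hasP; exists a.
rewrite mem_filter => /andP[cb sb] bmax.
move/(congr1 (mcoeff b)): sum0; rewrite mcoeff0 raddf_sum /= (bigD1_seq b) //=.
have [fb0 lb] := fs b sb.
rewrite mcoeffZ big_seq_cond big1 ?addr0 => [/eqP|x /andP[sx nxb]].
  by rewrite mulf_eq0 (negPf cb) /= -{1}lb mleadc_eq0 (negPf fb0).
rewrite mcoeffZ; have [->|cx] := eqVneq (c x) 0; first by rewrite mul0r.
have [_ lx] := fs x sx; rewrite mcoeff_gt_mlead ?mulr0 // lx lt_neqAle nxb.
by apply: bmax; rewrite mem_filter cx.
Qed.

Definition monomials (n m : nat) : seq 'X_{1..n} :=
  [seq s2m (val t) | t <- enum (basis n m)].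

Lemma monomials_uniq n m : uniq (monomials n m).
Proof. exact: uniq_basis. Qed.

Lemma mem_monomials n m a : (a \in monomials n m) = (mdeg a == m).
Proof. by rewrite [RHS]basis_cover. Qed.

Lemma size_monomials n m : size (monomials n.+1 m) = 'C(m + n, m).
Proof. by rewrite size_map -cardE; apply: card_sorted_tuples. Qed.

Lemma mem_compositions k m s :
  (s \in compositions k m) = (size s == k) && (sumn s == m).
Proof.
elim: k m s => [|k IH] m s.
  by rewrite /= fun_if; case: s => [|x s]; case: m => //.
have -> : compositions k.+1 m = flatten
    [seq [seq j :: s | s <- compositions k (m - j)] | j <- iota 0 m.+1] by [].
apply/flattenP/idP => [[l /mapP[j]]|].
  rewrite mem_iota ltnS => /andP[_ lejm] -> /mapP[t].
  rewrite IH => /andP[/eqP <- /eqP tm] -> /=; rewrite eqxx tm; lia.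
case: s => [//|x s]; rewrite [size _]/= [sumn _]/= eqSS => /andP[szs /eqP xsm].
exists [seq x :: t | t <- compositions k (m - x)].
  by apply/mapP; exists x; rewrite // mem_iota; lia.
by apply/mapP; exists s; rewrite // IH szs -xsm addKn eqxx.
Qed.

Lemma compositions_uniq k m : uniq (compositions k m).
Proof.
elim: k m => [|k IH] m; first by rewrite /=; case: ifP.
have -> : compositions k.+1 m = [seq j :: s | j <- iota 0 m.+1, s <- compositions k (m - j)] by [].
apply: allpairs_uniq_dep => [|j _|]; rewrite ?iota_uniq //.
by move=> [i s] [j t] _ _ /= [-> ->].
Qed.

Lemma perm_monomials_compositions n m :
  perm_eq (map (fun a : 'X_{1..n} => a : seq nat) (monomials n m)) (compositions n m).
Proof.
have inj : injective (fun a : 'X_{1..n} => a : seq nat).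
  by move=> a b /val_inj /val_inj.
apply: uniq_perm; rewrite ?compositions_uniq ?(map_inj_uniq inj) ?monomials_uniq //.
move=> s; rewrite mem_compositions; apply/mapP/andP => [[a]|].
  by rewrite mem_monomials => /eqP <- ->; rewrite size_tuple eqxx /mdeg sumnE.
move=> [szs /eqP sm]; exists (Multinom (Tuple szs)) => //.
by rewrite mem_monomials -sm /mdeg sumnE.
Qed.

Section HilbertFunction.
Variables (K : closedFieldType) (N : nat).
Implicit Types (X : pset K N) (p q : {mpoly K[N.+1]}).

Lemma vanishing_ideal0 X : vanishing_ideal X 0.
Proof. by move=> L _ v _; rewrite meval0. Qed.

Lemma vanishing_idealP X a p q :
  vanishing_ideal X p -> vanishing_ideal X q -> vanishing_ideal X (a *: p + q).
Proof.
by move=> Ip Iq L XL v vL; rewrite mevalD mevalZ (Ip L) // (Iq L) // mulr0 addr0.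
Qed.

Lemma vanishing_idealM X p q : vanishing_ideal X p -> vanishing_ideal X (p * q).
Proof. by move=> Ip L XL v vL; rewrite mevalM (Ip L) // mul0r. Qed.

(** Coefficients are functions on [nat], so that splitting a concatenation only shifts an index. *)
Definition independent_mod (I : {mpoly K[N.+1]} -> Prop) (s : seq {mpoly K[N.+1]}) :=
  forall c : nat -> K, I (\sum_(i < size s) c i *: s`_i) ->
  forall i, (i < size s)%N -> c i = 0.

Lemma mpoly_of_dhomog_sum m r (c : 'I_r -> K) (t : r.-tuple (dhomog N.+1 K m)) :
  val (\sum_i c i *: t`_i) = \sum_i c i *: (val t`_i : {mpoly K[N.+1]}).
Proof. exact: (raddf_sum (@mpoly_of_dhomog N.+1 K m)). Qed.

Lemma hilbert_value_exists X m : exists h, hilbert_value X m h.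
Proof.
have [||U HU] := @vspace_of_linear_predicate K (dhomog N.+1 K m : vectType K)
   (fun p : dhomog N.+1 K m => vanishing_ideal X (val p)).
- exact: vanishing_ideal0.
- by move=> a p q; apply: vanishing_idealP.
by exists (\dim {: dhomog N.+1 K m} - \dim U)%N, U.
Qed.

Lemma independent_mod_free X m (U : {vspace dhomog N.+1 K m})
    (s : seq (dhomog N.+1 K m)) :
  (forall p : dhomog N.+1 K m, p \in U -> vanishing_ideal X (val p)) ->
  independent_mod (vanishing_ideal X) (map (@mpoly_of_dhomog N.+1 K m) s) ->
  free s /\ (<<s>> :&: U)%VS = 0%VS.
Proof.
move=> HU ind.
have ind' (c : 'I_(size s) -> K) : vanishing_ideal X (val (\sum_i c i *: s`_i)) ->
    forall i, c i = 0.
  move=> Ic i; pose c' j := if insub j is Some k then c k else 0.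
  have c'E (k : 'I_(size s)) : c' k = c k by rewrite /c' valK.
  rewrite -c'E; apply: ind; rewrite size_map //.
  suff -> : \sum_(k < size s) c' k *: (map (@mpoly_of_dhomog N.+1 K m) s)`_k =
    val (\sum_i c i *: s`_i) by [].
  rewrite (mpoly_of_dhomog_sum c (in_tuple s)); apply: eq_bigr => k _.
  by rewrite c'E (nth_map 0).
split.
  apply/(freeP (X := in_tuple s)) => c c0; apply: ind'.
  by rewrite (_ : \sum_i _ = 0) //; exact: vanishing_ideal0.
apply/eqP; rewrite -subv0; apply/subvP => p; rewrite memv_cap => /andP[sp Up].
rewrite memv0; move: (sp) => /(coord_span (X := in_tuple s)) E.
have c0 : forall i, coord (in_tuple s) i p = 0.
  by apply: ind'; rewrite /= -[X in val X]E; apply: HU.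
by rewrite E big1 // => i _; rewrite c0 scale0r.
Qed.

(** The span of [s] meets the degree [m] part of I(X) trivially, so its dimension is at most the
    codimension of that part. *)
Lemma hilbert_value_ge X m h s : hilbert_value X m h ->
  (forall p, p \in s -> p \is m.-homog) ->
  independent_mod (vanishing_ideal X) s -> (size s <= h)%N.
Proof.
move=> [U [HU ->]] hs ind.
have [t st] : exists t : seq (dhomog N.+1 K m), s = map (@mpoly_of_dhomog N.+1 K m) t.
  exists [seq indhomog m p | p <- s]; rewrite -map_comp -[LHS]map_id.
  by apply/eq_in_map => p sp /=; rewrite /indhomog insubdK //; apply: hs.
subst s.
have [fr cap0] := independent_mod_free (fun p : dhomog N.+1 K m => proj1 (HU p)) ind.
rewrite size_map -(eqP fr).
rewrite leq_subRL; last by apply: dimvS; apply: subvf.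
by rewrite addnC -(dimv_disjoint_sum cap0); apply: dimvS; apply: subvf.
Qed.

(** A basis of a complement of the degree [m] part of I(X) will do. *)
Lemma hilbert_value_independent X m h : hilbert_value X m h ->
  exists s, [/\ size s = h, (forall p, p \in s -> p \is m.-homog) &
                independent_mod (vanishing_ideal X) s].
Proof.
move=> [U [HU ->]]; pose W := (U^C)%VS.
have cap0 : (U :&: W)%VS = 0%VS by apply: capv_compl.
exists (map (@mpoly_of_dhomog N.+1 K m) (vbasis W)); split.
- by rewrite size_map size_tuple dimv_compl.
- by move=> _ /mapP[p _ ->]; apply: dhomog_is_dhomog.
move=> c; rewrite size_map => Ic i lti.
have [k ->] : exists k : 'I_(\dim W), i = k.
  by move: lti; rewrite size_tuple => lti; exists (Ordinal lti).
pose c' (k : 'I_(\dim W)) := c k.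
suff : \sum_k c' k *: (vbasis W)`_k = 0.
  by move=> sum0; apply: (freeP (basis_free (vbasisP W)) c' sum0).
apply/eqP; rewrite -memv0 -cap0 memv_cap; apply/andP; split.
  apply/HU; rewrite mpoly_of_dhomog_sum.
  congr vanishing_ideal: Ic; rewrite size_tuple.
  by apply: eq_bigr => j _; rewrite (nth_map 0) // size_tuple.
by apply: memv_suml => j _; rewrite memvZ // vbasis_mem // mem_nth // size_tuple.
Qed.

Lemma sumn_mdeg n (a : 'X_{1..n}) : sumn a = mdeg a.
Proof. by rewrite sumnE. Qed.

(** * Standard monomials *)

Definition lead_exponent_of X (a : seq nat) : Prop :=
  exists p, [/\ p != 0, p \is (sumn a).-homog, vanishing_ideal X p & mlead p = a :> seq nat].

(** Decided classically, because [count] needs a boolean predicate. *)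
Definition standard X (a : seq nat) : bool :=
  if excluded_middle_informative (lead_exponent_of X a) then false else true.

Lemma standardP X a : reflect (~ lead_exponent_of X a) (standard X a).
Proof. by rewrite /standard; case: excluded_middle_informative => h; constructor; auto. Qed.

(** Multiplication by a monomial moves a leading exponent to any larger one, so the non-standard
    exponents form an up-set. *)
Lemma standard_down_set X : down_set N.+1 (standard X).
Proof.
move=> s t szs szt le /standardP nt; apply/standardP => -[p [p0 hp Ip lp]].
pose b : 'X_{1..N.+1} := [multinom (nth 0 t i - nth 0 s i)%N | i < N.+1].
have lpb : (mlead p + b)%MM = t :> seq nat.
  apply: (@eq_from_nth _ 0%N); first by rewrite size_tuple szt.
  move=> i; rewrite size_tuple => lti; rewrite -[i]/(val (Ordinal lti)) -mnm_nth mnmDE mnmE.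
  rewrite (mnm_nth 0) lp /= subnKC //.
  move: le; rewrite all2E => /andP[_ /(all_nthP (0, 0)%N) /(_ i)].
  by rewrite size_zip szs szt minnn => /(_ lti); rewrite nth_zip ?szs ?szt.
apply: nt; exists (p * 'X_[b]); split.
- by rewrite mulf_neq0 // -msupp_eq0 msuppX.
- have -> : sumn t = (sumn s + mdeg b)%N by rewrite -lp -lpb !sumn_mdeg mdegD.
  by apply: dhomogM => //; rewrite dhomogX.
- exact: vanishing_idealM.
by rewrite mleadM ?mleadXm ?lpb // -msupp_eq0 msuppX.
Qed.

Lemma lead_independent (s : seq 'X_{1..N.+1}) (f : 'X_{1..N.+1} -> {mpoly K[N.+1]})
    (c : nat -> K) :
  uniq s -> {in s, forall a, f a != 0 /\ mlead (f a) = a} ->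
  \sum_(i < size s) c i *: (map f s)`_i = 0 -> forall i, (i < size s)%N -> c i = 0.
Proof.
move=> us fs sum0 i lti; rewrite -[i](index_uniq 0%MM lti us).
apply: (mlead_free (c := fun a => c (index a s)) us fs); last exact: mem_nth.
rewrite (big_nth 0%MM) big_mkord -[RHS]sum0; apply: eq_bigr => j _.
by rewrite index_uniq // (nth_map 0%MM).
Qed.

(** Standard monomials are independent modulo I(X): a nonzero relation would be a form in I(X) with
    a standard leading exponent. The other monomials are leading in forms of I(X), which are
    independent. As the two numbers add up to the dimension of all forms, both bounds are sharp. *)
Lemma hilbert_value_standard X m h : hilbert_value X m h ->
  h = count (standard X) (compositions N.+1 m).
Proof.
move=> Hh; rewrite -(seq.permP (perm_monomials_compositions _ _)) count_map.
set st := preim _ _; rewrite -size_filter.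
have geS : (size (filter st (monomials N.+1 m)) <= h)%N.
  rewrite -(size_map (fun a => 'X_[a] : {mpoly K[N.+1]})).
  apply: (hilbert_value_ge Hh) => [_ /mapP[a + ->]|c].
    by rewrite mem_filter mem_monomials dhomogX => /andP[].
  rewrite size_map; set s := filter _ _; set p := \sum_(i < _) _ => Ip.
  have us : uniq s by rewrite filter_uniq ?monomials_uniq.
  have [p0|nzp] := eqVneq p 0.
    apply: (@lead_independent s (fun a => 'X_[a])) => // a _.
    by rewrite mleadXm -msupp_eq0 msuppX.
  have ps a : a \in msupp p -> a \in s.
    apply: contraLR => nas; rewrite -mcoeff_eq0 /p raddf_sum /=.
    rewrite big1 // => i _; rewrite mcoeffZ (nth_map 0%MM) // mcoeffX.
    by case: eqP => [E|_]; rewrite ?mulr0 //; case/negP: nas; rewrite -E mem_nth.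
  have hp : p \is m.-homog.
    by apply/dhomogP => a /ps; rewrite mem_filter mem_monomials => /andP[_ /eqP].
  have := ps _ (mlead_supp nzp); rewrite mem_filter mem_monomials.
  move=> /andP[/standardP ns /eqP lpm]; case: ns; exists p; split=> //.
  by rewrite sumn_mdeg lpm.
have [U [HU hE]] := Hh.
pose P a p := [/\ p != 0, p \is (sumn a).-homog, vanishing_ideal X p & mlead p = a :> seq nat].
pose lp (a : 'X_{1..N.+1}) : {mpoly K[N.+1]} := epsilon (inhabits 0) (P a).
have lpP a : ~~ st a -> P a (lp a).
  by move/standardP/NNPP; apply: epsilon_spec.
set s := filter (predC st) (monomials N.+1 m).
have sP a : a \in s -> ~~ st a /\ sumn a = m.
  by rewrite mem_filter mem_monomials sumn_mdeg => /andP[h1 /eqP h2].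
have us : uniq s by rewrite filter_uniq ?monomials_uniq.
have geR : (size s <= \dim U)%N.
  pose t : seq (dhomog N.+1 K m) := [seq indhomog m (lp a) | a <- s].
  have tE : map (@mpoly_of_dhomog N.+1 K m) t = map lp s.
    rewrite -map_comp; apply/eq_in_map => a /sP[/lpP[_ hl _ _] am].
    by rewrite /= /indhomog insubdK //; rewrite -am.
  have szt : size t = size s by rewrite size_map.
  have frt : free t.
    apply/(freeP (X := in_tuple t)) => c c0 i.
    pose c' j := if insub j is Some k then c k else 0.
    have c'E (k : 'I_(size t)) : c' k = c k by rewrite /c' valK.
    rewrite -c'E; apply: (@lead_independent s lp) => //.
    - by move=> a /sP[/lpP[l0 _ _ la] _]; split=> //; apply/val_inj/val_inj.
    - have := congr1 (@mpoly_of_dhomog N.+1 K m) c0.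
      rewrite (mpoly_of_dhomog_sum c (in_tuple t)) -tE -szt.
      rewrite [RHS]/= => sum0; apply: etrans sum0.
      by apply: eq_bigr => k _; rewrite c'E (nth_map 0).
    by rewrite -szt.
  rewrite -szt -(eqP frt); apply: dimvS; apply/span_subvP => _ /mapP[a sa ->].
  have [/lpP[_ hl Il _] am] := sP a sa.
  by apply/HU; rewrite /indhomog insubdK // -am.
have dimF : \dim {: dhomog N.+1 K m} = size (monomials N.+1 m).
  by rewrite size_monomials dimvf.
have := count_predC st (monomials N.+1 m).
rewrite -!size_filter -/s; move: geS geR; rewrite hE dimF.
set A := size _; set B := size _; set C := size _; lia.
Qed.

Lemma hilbert_polynomial_exists X : exists P : {poly rat}, hilbert_polynomial X P.
Proof.
have [P [m0 HP]] := eventually_poly_down_set (@standard_down_set X).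
exists P, m0 => m le; have [h Hh] := hilbert_value_exists X m.
by exists h => //; rewrite HP // (hilbert_value_standard Hh).
Qed.

End HilbertFunction.

(** * Chains of irreducible closed sets *)

Section Dimension.
Variables (K : closedFieldType) (N : nat).
Implicit Types (X Z : pset K N) (L : proj_space K N) (p q f g : {mpoly K[N.+1]}).

Lemma proj_space_gen L : exists2 v, v != 0 & val L = <[v]>%VS.
Proof.
have dL : \dim (val L) = 1%N by apply/eqP; exact: (valP L).
have vL := memv_pick (val L).
have nzv : vpick (val L) != 0 by rewrite vpick0 -dimv_eq0 dL.
exists (vpick (val L)) => //; apply/eqP; rewrite eq_sym eqEdim dL dim_vline nzv andbT.
by rewrite -memvE.
Qed.

Lemma proj_space_line (v : 'rV[K]_N.+1) : v != 0 ->
  exists L : proj_space K N, val L = <[v]>%VS.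
Proof.
move=> nzv; have dv : \dim <[v]> == 1%N by rewrite dim_vline nzv.
by exists (exist _ <[v]>%VS dv).
Qed.

Lemma meval_homog_scale p m (v : 'rV[K]_N.+1) a :
  p \is m.-homog -> p.@[(a *: v) 0] = a ^+ m * p.@[v 0].
Proof.
move=> hp; rewrite !mevalE mulr_sumr big_seq [RHS]big_seq; apply: eq_bigr => b bp.
rewrite mulrCA; congr (_ * _); have <- : mdeg b = m := dhomog_mf hp bp.
rewrite mdegE.
rewrite -prodrXr -big_split /=; apply: eq_bigr => i _.
by rewrite mxE exprMn.
Qed.

Lemma vanishes_at_homog p m L v : p \is m.-homog -> val L = <[v]>%VS ->
  vanishes_at p L <-> p.@[v 0] = 0.
Proof.
move=> hp EL; split=> [|pv u]; first by apply; rewrite EL memv_line.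
by rewrite EL => /vlineP[a ->]; rewrite (meval_homog_scale _ _ hp) pv mulr0.
Qed.

Lemma vanishing_idealS X Z p :
  psubset Z X -> vanishing_ideal X p -> vanishing_ideal Z p.
Proof. by move=> sZX Ip L /sZX; apply: Ip. Qed.

Lemma zariski_closed_zero_locus1 p m : p \is m.-homog ->
  zariski_closed (zero_locus (eq p) : pset K N).
Proof. by move=> hp; exists (eq p); split=> // _ <-; exists m. Qed.

(** If neither [A] nor [B] contains [X], each has an equation that does not vanish on [X]; the
    product of the two does. *)
Lemma irreducible_of_prime X : (exists L, X L) ->
  (forall p q, vanishing_ideal X (p * q) -> vanishing_ideal X p \/ vanishing_ideal X q) ->
  irreducible X.
Proof.
move=> nX primeX; split=> // A B [TA [hA AE]] [TB [hB BE]] XAB.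
apply: NNPP => /not_or_and[nA nB].
have wit (C : pset K N) T : (forall L, C L <-> zero_locus T L) -> ~ psubset X C ->
    exists2 p, T p & ~ vanishing_ideal X p.
  move=> CE nC; apply: NNPP => no; apply: nC => L XL; apply/CE => p Tp.
  by apply: NNPP => nv; apply: no; exists p => // Ip; apply: nv; apply: Ip.
have [p Tp np] := wit _ _ AE nA; have [q Tq nq] := wit _ _ BE nB.
have [] // := primeX p q => L XL v vL; rewrite mevalM.
have [/AE AL|/BE BL] := XAB L XL; first by rewrite (AL p) // mul0r.
by rewrite (BL q) // mulr0.
Qed.

(** [X] is covered by the zero loci of [f] and [g], hence lies in one of them. Homogeneity makes
    these loci closed and lets one representative of a line decide. *)
Lemma irreducible_cancel X f g m k : irreducible X ->
  f \is m.-homog -> g \is k.-homog -> vanishing_ideal X (f * g) ->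
  ~ vanishing_ideal X f -> vanishing_ideal X g.
Proof.
move=> [_ irrX] hf hg Ifg nf.
have [|sXf|sXg L /sXg] := irrX _ _ (zariski_closed_zero_locus1 hf)
    (zariski_closed_zero_locus1 hg).
- move=> L XL; have [v nzv EL] := proj_space_gen L.
  have /eqP : (f * g).@[v 0] = 0 by apply: (Ifg L XL); rewrite EL memv_line.
  rewrite mevalM mulf_eq0 => /orP[] /eqP h; [left|right] => _ <-.
    by apply/(vanishes_at_homog hf EL).
  by apply/(vanishes_at_homog hg EL).
- by case: nf => L /sXf; apply.
- by apply.
Qed.

Lemma homog1 : (1 : {mpoly K[N.+1]}) \is 0.-homog.
Proof. exact: dhomog1. Qed.

Lemma irreducible_cancelX X f g m k n : irreducible X ->
  f \is m.-homog -> g \is k.-homog -> vanishing_ideal X (g * f ^+ n) ->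
  ~ vanishing_ideal X f -> vanishing_ideal X g.
Proof.
move=> irrX hf hg + nf; elim: n => [|n IH]; first by rewrite expr0 mulr1.
have hgn : g * f ^+ n \is (k + m * n).-homog by apply: dhomogM => //; apply: dhomogMn.
by rewrite exprS mulrCA => /(irreducible_cancel irrX hf hgn) h; apply: IH (h nf).
Qed.

Lemma vanishing_ideal_nonempty X : (exists L, X L) -> ~ vanishing_ideal X 1.
Proof.
move=> [L XL] /(_ L XL 0 (mem0v _)); rewrite meval1 => /eqP.
by rewrite oner_eq0.
Qed.

Lemma sum_cat_coef (c : nat -> K) (s1 s2 : seq {mpoly K[N.+1]}) :
  \sum_(i < size (s1 ++ s2)) c i *: (s1 ++ s2)`_i =
  \sum_(i < size s1) c i *: s1`_i + \sum_(i < size s2) c (size s1 + i)%N *: s2`_i.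
Proof.
rewrite size_cat big_split_ord /=; congr (_ + _); apply: eq_bigr => i _.
  by rewrite nth_cat ltn_ord.
by rewrite nth_cat ltnNge leq_addr /= addKn.
Qed.

Lemma sum_map_mul_coef (c : nat -> K) f (s : seq {mpoly K[N.+1]}) :
  \sum_(i < size (map ( *%R f) s)) c i *: (map ( *%R f) s)`_i =
  f * \sum_(i < size s) c i *: s`_i.
Proof.
rewrite mulr_sumr size_map; apply: eq_bigr => i _.
by rewrite (nth_map 0) // scalerAr.
Qed.

(* The monomials of degree [k] in [f 0, ..., f i]. *)
Fixpoint power_products (f : nat -> {mpoly K[N.+1]}) (i : nat) : nat -> seq {mpoly K[N.+1]} :=
  if i is i'.+1 then
    fix F k := power_products f i' k ++
      (if k is k'.+1 then map ( *%R (f i)) (F k') else [::])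
  else fun k => [:: f 0%N ^+ k].

Lemma power_productsS (f : nat -> {mpoly K[N.+1]}) i k :
  power_products f i.+1 k = power_products f i k ++
  (if k is k'.+1 then map ( *%R (f i.+1)) (power_products f i.+1 k') else [::]).
Proof. by case: k. Qed.

Lemma size_power_products (f : nat -> {mpoly K[N.+1]}) i k :
  size (power_products f i k) = 'C(k + i, i).
Proof.
elim: i k => [|i IHi] k; first by rewrite /= addn0 bin0.
elim: k => [|k IHk]; first by rewrite power_productsS cats0 IHi !add0n !binn.
by rewrite power_productsS size_cat size_map IHk IHi !addSn !addnS [RHS]binS addnC.
Qed.

Lemma homog_power_products (f : nat -> {mpoly K[N.+1]}) E i k :
  (forall j, (j <= i)%N -> f j \is E.-homog) ->
  forall p, p \in power_products f i k -> p \is (E * k).-homog.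
Proof.
elim: i k => [|i IHi] k hf p.
  by rewrite inE => /eqP ->; apply: dhomogMn; apply: hf.
elim: k p => [|k IHk] p.
  by rewrite power_productsS cats0; apply: IHi => j lej; apply: hf; apply: leqW.
rewrite power_productsS mem_cat => /orP[|/mapP[q /IHk hq ->]].
  by apply: IHi => j lej; apply: hf; apply: leqW.
by rewrite mulnS; apply: dhomogM => //; apply: hf.
Qed.

(* Modulo [I(Z i.+1)] a relation reads [u + f i.+1 * w] with [u] free of
   [f i.+1]; as [f i.+1] is in [I(Z i)] it gives [u = 0] by induction on [i],
   then [w = 0] by induction on the degree, [f i.+1] being a nonzerodivisor. *)
Lemma power_products_independent (Z : nat -> pset K N)
    (f : nat -> {mpoly K[N.+1]}) E s :
  (forall i, (i <= s)%N ->
    [/\ irreducible (Z i), f i \is E.-homog & ~ vanishing_ideal (Z i) (f i)]) ->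
  (forall i, (i < s)%N ->
    psubset (Z i) (Z i.+1) /\ vanishing_ideal (Z i) (f i.+1)) ->
  forall i k, (i <= s)%N ->
  independent_mod (vanishing_ideal (Z i)) (power_products f i k).
Proof.
move=> H1 H2; elim=> [|i IHi] k leis.
  have [irr hf nf] := H1 0%N leis.
  move=> c; rewrite big_ord_recl big_ord0 addr0 /= => Ic [|//] _.
  apply/eqP/negPn/negP => c0.
  case: (vanishing_ideal_nonempty (proj1 irr)).
  apply: (irreducible_cancelX (n := k) irr hf homog1) => //.
  rewrite mul1r -[f 0%N ^+ k](scalerK c0) -[_ *: _]addr0.
  by apply: vanishing_idealP => //; apply: vanishing_ideal0.
have [irr hf nf] := H1 _ leis; have [sZ If] := H2 _ leis.
have {}IHi k' : independent_mod (vanishing_ideal (Z i)) (power_products f i k').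
  exact: IHi (ltnW leis).
elim: k => [|k IHk] c.
  by rewrite power_productsS cats0 => /(vanishing_idealS sZ); apply: IHi.
rewrite power_productsS sum_cat_coef.
rewrite (sum_map_mul_coef (fun j => c (size (power_products f i k.+1) + j)%N)).
rewrite size_cat size_map => Ic.
set u := (X in X + _) in Ic; set w := (X in _ * X) in Ic.
have c0 j : (j < size (power_products f i k.+1))%N -> c j = 0.
  apply: IHi; rewrite -/u.
  have -> : u = (-1) *: (f i.+1 * w) + (u + f i.+1 * w).
    by rewrite scaleN1r addrC addrK.
  apply: vanishing_idealP; last exact: vanishing_idealS sZ Ic.
  exact: vanishing_idealM.
have u0 : u = 0 by rewrite /u big1 // => j _; rewrite c0 ?scale0r.
rewrite u0 add0r in Ic.
have hw : w \is (E * k).-homog.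
  apply: rpred_sum => j _; apply: rpredZ; apply: (@homog_power_products f E i.+1).
    by move=> j' lej; have [] := H1 j' (leq_trans lej leis).
  exact: mem_nth.
have c1 := IHk (fun j => c (size (power_products f i k.+1) + j)%N)
  (irreducible_cancel irr hf hw Ic nf).
move=> j ltj; have [|le] := ltnP j (size (power_products f i k.+1)); first exact: c0.
by rewrite -(subnKC le); apply: c1; rewrite ltn_subLR.
Qed.

(** Separating forms of a common degree [E] yield C(n + s, s) independent power products of degree
    [n * E], for every [n]; against the bound on the Hilbert function this growth forces
    [s <= r.+1]. *)
Lemma irreducible_chain_bound X r :
  (forall m h, hilbert_value X m h -> (h <= m.+1 * 'C(m + r, r))%N) ->
  forall s (Z : nat -> pset K N), irreducible_chain X s Z -> (s <= r.+1)%N.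
Proof.
move=> Hh s Z [HZ HS].
have irrZ i : (i <= s)%N -> irreducible (Z i) by move/HZ => [].
(* A coordinate that is nonzero at a point of [Z 0] vanishes identically on no [Z i], as they all
   contain this point. *)
have [k nk] : exists k, forall i, (i <= s)%N -> ~ vanishing_ideal (Z i) 'X_k.
  have [_ [[L ZL] _] _] := HZ 0%N isT; have [v nzv EL] := proj_space_gen L.
  have [k nvk] : exists k, v 0 k != 0 by apply/existsP; rewrite -negb_forall;
    apply: contra nzv => /forallP h; apply/eqP/rowP => k; rewrite mxE; apply/eqP.
  exists k => i leis Ii; have ZiL : Z i L.
    elim: i leis {Ii} => // i IH lt; have [sZ _] := HS i lt.
    by apply: sZ; apply: IH; apply: ltnW.
  have := Ii L ZiL v; rewrite EL memv_line mevalXU => /(_ isT)/eqP.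
  by rewrite (negPf nvk).
have sep i : exists ge : {mpoly K[N.+1]} * nat, (i < s)%N ->
    [/\ ge.1 \is ge.2.-homog, vanishing_ideal (Z i) ge.1 & ~ vanishing_ideal (Z i.+1) ge.1].
  have [lt|] := ltnP i s; last by exists (0, 0%N).
  have [_ nS] := HS i lt; have [[T [hT TE]] _ _] := HZ i (ltnW lt).
  apply: NNPP => no; apply: nS => L ZL; apply/TE => p Tp.
  apply: NNPP => nv; apply: no; have [m hp] := hT p Tp.
  exists (p, m) => _; split=> //; first by move=> L' /TE; apply.
  by move=> Ip; apply: nv; apply: Ip.
pose g i := (proj1_sig (constructive_indefinite_description _ (sep i))).1.
pose e i := (proj1_sig (constructive_indefinite_description _ (sep i))).2.
have gP i : (i < s)%N -> [/\ g i \is (e i).-homog, vanishing_ideal (Z i) (g i)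
    & ~ vanishing_ideal (Z i.+1) (g i)].
  exact: (proj2_sig (constructive_indefinite_description _ (sep i))).
pose E := (\sum_(i < s) e i)%N.
have leE i : (i < s)%N -> (e i <= E)%N.
  by move=> lt; rewrite /E (bigD1 (Ordinal lt)) //= leq_addr.
pose x : {mpoly K[N.+1]} := 'X_k.
have hx : x \is 1.-homog by rewrite dhomogX /= mdeg1.
(* Powers of the coordinate [x] raise all separating forms to degree [E]; [f 0] only has to be
   nonzero on [Z 0]. *)
pose f i := if i is j.+1 then g j * x ^+ (E - e j) else 1 * x ^+ E.
have hxn n : x ^+ n \is n.-homog by rewrite -[n in n.-homog]mul1n; apply: dhomogMn.
apply: (@binomial_growth _ _ E) => n.
rewrite -(size_power_products f).
have [h hv] := hilbert_value_exists X (n * E).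
apply: leq_trans (Hh _ _ hv); apply: (hilbert_value_ge hv).
  move=> p; rewrite mulnC; apply: homog_power_products => -[|j] lej.
    by rewrite /f mul1r.
  by have [hg _ _] := gP j lej; rewrite -(subnKC (leE j lej)); apply: dhomogM.
move=> c Ic; apply: (@power_products_independent Z f E s) => //.
- case=> [|j] lej; split; try exact: irrZ.
  + by rewrite /f mul1r.
  + move=> /(irreducible_cancelX (irrZ _ lej) hx homog1).
    move/(_ (nk _ lej)); apply: vanishing_ideal_nonempty.
    by have [] := irrZ _ lej.
  + by have [hg _ _] := gP j lej; rewrite -(subnKC (leE j lej)); apply: dhomogM.
  have [hg _ ng] := gP j lej.
  by move=> /(irreducible_cancelX (irrZ _ lej) hx hg) /(_ (nk _ lej)).
- move=> i lt; split; first by have [] := HS i lt.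
  by apply: vanishing_idealM; have [] := gP i lt.
by apply: vanishing_idealS Ic; have [] := HZ s (leqnn s).
Qed.

End Dimension.

(** * Polynomial substitutions *)

Lemma mmap_comp n (R : nzRingType) (S T : comNzRingType) (g : {rmorphism S -> T})
    (f : R -> S) (h : 'I_n -> S) p :
  g (mmap f h p) = mmap (g \o f) (g \o h) p.
Proof.
rewrite /mmap rmorph_sum /=; apply: eq_bigr => a _; rewrite rmorphM /=.
by congr (_ * _); rewrite /mmap1 rmorph_prod; apply: eq_bigr => i _; rewrite rmorphXn.
Qed.

Lemma eq_mmap n (R S : nzRingType) (f f' : R -> S) (h h' : 'I_n -> S) p :
  f =1 f' -> h =1 h' -> mmap f h p = mmap f' h' p.
Proof.
move=> ef eh; rewrite /mmap; apply: eq_bigr => a _; rewrite ef; congr (_ * _).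
by rewrite /mmap1; apply: eq_bigr => i _; rewrite eh.
Qed.

(** The leading coefficient of [p] reappears in [muni p], at the exponent of the last variable and
    then at the remaining exponents. *)
Lemma muni_inj_eq0 n (R : nzRingType) (p : {mpoly R[n.+1]}) : muni p = 0 -> p = 0.
Proof.
move=> p0; apply/eqP; rewrite -mleadc_eq0; set b := mlead p.
have : ((muni p)`_(b ord_max))@_[multinom b (widen_ord (leqnSn n) i) | i < n] = 0.
  by rewrite p0 coef0 mcoeff0.
rewrite muniE coef_sum raddf_sum /=.
have [->|nzp] := eqVneq p 0; first by rewrite mcoeff0 eqxx.
rewrite (bigD1_seq b) ?msupp_uniq ?mlead_supp //= big1 ?addr0 => [|a nab].
  by rewrite coefZ coefXn eqxx mulr1 mcoeffZ mcoeffX eqxx mulr1 => ->.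
rewrite coefZ coefXn; have [Ea|_] := eqVneq (b ord_max) (a ord_max); last by rewrite mulr0 mcoeff0.
rewrite mulr1 mcoeffZ mcoeffX; case: eqP => [E|_]; last by rewrite mulr0.
case/eqP: nab; apply/mnmP => i.
have [j|] := unliftP ord_max i; last by move=> ->.
move=> Ej; have -> : i = widen_ord (leqnSn n) j.
  by apply: val_inj; rewrite Ej /= /bump leqNgt ltn_ord.
by have := congr1 (fun m : 'X_{1..n} => m j) E; rewrite /= !mnmE.
Qed.

Definition eval2 (R : nzRingType) (A : comNzRingType) (g : {rmorphism R -> A}) (y : A) :
  {poly R} -> A := horner_eval y \o map_poly g.

HB.instance Definition _ R A g y := GRing.RMorphism.on (@eval2 R A g y).

Lemma eval2C R A g y c : @eval2 R A g y c%:P = g c.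
Proof. by rewrite /eval2 /= map_polyC /horner_eval hornerC. Qed.

Lemma eval2X R A g y : @eval2 R A g y 'X = y.
Proof. by rewrite /eval2 /= map_polyX /horner_eval hornerX. Qed.

Lemma poly_exists_nonroot (K : closedFieldType) (R : nzRingType)
    (g : {rmorphism R -> K}) (p : {poly R}) i :
  g p`_i != 0 -> exists x, eval2 g x p != 0.
Proof.
move=> nz; have /closed_nonrootP[x nr] : map_poly g p != 0.
  by apply: contra nz => /eqP/(congr1 (fun q : {poly K} => q`_i)); rewrite coef_map coef0 => ->.
by exists x.
Qed.

(** By induction the leading coefficient in the last variable is nonzero at some [w]; the univariate
    polynomial left after evaluation at [w] has a nonroot. *)
Lemma mpoly_exists_nonroot (K : closedFieldType) n (p : {mpoly K[n]}) :
  p != 0 -> exists v, p.@[v] != 0.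
Proof.
elim: n p => [|n IH] p nzp.
  exists (fun _ => 0); rewrite [p]nvar0_mpolyC mevalC.
  by apply: contra nzp; rewrite [p]nvar0_mpolyC mcoeffC eqxx mulr1 mpolyC_eq0.
have : muni p != 0 by apply: contra nzp => /eqP/muni_inj_eq0 ->.
rewrite -lead_coef_eq0 => /IH[w /poly_exists_nonroot[x]].
rewrite /muni mmap_comp => nz; exists (eval2 (meval w) x \o
  (fun i => match split (cast_ord (esym (addn1 n)) i) with
  | inl j => ('X_j)%:P | inr _ => 'X end)).
apply: contra nz; rewrite /meval => /eqP nz; apply/eqP; rewrite -[RHS]nz.
by apply: eq_mmap => // c; rewrite /= eval2C; apply: mevalC.
Qed.

Lemma homog_prod_const (R : comNzRingType) N (I : Type) (r : seq I) (F : I -> {mpoly R[N]}) e :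
  (forall i, F i \is e.-homog) -> \prod_(i <- r) F i \is (e * size r).-homog.
Proof.
move=> hF; elim: r => [|i r IH]; first by rewrite big_nil muln0; apply: dhomog1.
by rewrite big_cons mulnS; apply: dhomogM.
Qed.

Lemma homog_det (R : comNzRingType) N m (A : 'M[{mpoly R[N]}]_m) :
  (forall i j, A i j \is 1.-homog) -> \det A \is m.-homog.
Proof.
move=> hA; apply: rpred_sum => s _; rewrite rpredMsign.
have := homog_prod_const (index_enum 'I_m) (fun i => hA i (s i)).
by rewrite mul1n /index_enum -enumT size_enum_ord.
Qed.

(** * Coordinate subspaces *)

Section CoordinateSubspace.
Variables (K : closedFieldType) (N : nat).
Implicit Types C : pred 'I_N.+1.

Definition coord_subspace C : pset K N :=
  fun L => forall v : 'rV[K]_N.+1, v \in val L -> forall k, ~~ C k -> v 0 k = 0.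

Lemma coord_subspace_line C (v : 'rV[K]_N.+1) (L : proj_space K N) : val L = <[v]>%VS ->
  (forall k, ~~ C k -> v 0 k = 0) -> coord_subspace C L.
Proof. by move=> EL v0 u; rewrite EL => /vlineP[a ->] k Ck; rewrite mxE v0 ?mulr0. Qed.

Lemma coord_subspace_closed C : zariski_closed (coord_subspace C).
Proof.
exists (fun p => exists2 k, ~~ C k & p = 'X_k); split=> [p [k _ ->]|L].
  by exists 1%N; rewrite dhomogX /= mdeg1.
split=> [CL p [k Ck ->] v vL|CL v vL k Ck]; first by rewrite mevalXU; apply: CL.
by rewrite -(mevalXU (v 0)); apply: (CL 'X_k) => //; exists k.
Qed.

Lemma coord_subspace_delta C k : C k ->
  exists2 L, coord_subspace C L & val L = <[delta_mx 0%R k : 'rV[K]_N.+1]>%VS.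
Proof.
move=> Ck; have [|L EL] := @proj_space_line K N (delta_mx 0 k).
  by apply/eqP => /rowP/(_ k)/eqP; rewrite !mxE !eqxx oner_eq0.
exists L => //; apply: coord_subspace_line EL _ => l; rewrite mxE eqxx /=.
by case: eqP => // ->; rewrite Ck.
Qed.

(** The vanishing ideal is the kernel of the substitution of 0 for the coordinates outside [C], a
    morphism into a domain, hence prime. *)
Lemma coord_subspace_irreducible C k : C k -> irreducible (coord_subspace C).
Proof.
move=> Ck; have [L0 CL0 _] := coord_subspace_delta Ck.
pose t := [tuple (if C l then 'X_l else 0 : {mpoly K[N.+1]}) | l < N.+1].
have evt p (v : 'I_N.+1 -> K) : (p \mPo t).@[v] = p.@[fun l => if C l then v l else 0].
  rewrite comp_mpoly_meval; apply: meval_eq => l; rewrite tnth_mktuple.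
  by case: ifP => _; rewrite ?mevalXU ?meval0.
have vE p : vanishing_ideal (coord_subspace C) p <-> p \mPo t = 0.
  split=> [Ip|p0 L CL v vL]; last first.
    have := evt p (v 0); rewrite p0 meval0 => p0'; rewrite p0'.
    by apply: meval_eq => l; case: ifP => // /negbT /(CL v vL).
  apply/eqP/negPn/negP => /mpoly_exists_nonroot[v]; rewrite evt.
  pose u : 'rV[K]_N.+1 := \row_l (if C l then v l else 0).
  have -> : p.@[fun l => if C l then v l else 0] = p.@[u 0].
    by apply: meval_eq => l; rewrite mxE.
  (* The zero vector spans no point but lies on every line, in particular on [L0]. *)
  have [->|nzu] := eqVneq u 0; first by rewrite (Ip L0) ?eqxx // mem0v.
  have [L EL] := proj_space_line nzu; rewrite (Ip L) ?eqxx ?EL ?memv_line //.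
  by apply: coord_subspace_line EL _ => l /negPf Cl; rewrite mxE Cl.
apply: irreducible_of_prime => [|p q]; first by exists L0.
rewrite !vE rmorphM => /eqP; rewrite mulf_eq0.
by case/orP => /eqP; [left|right].
Qed.

Lemma coord_subspaceS C C' : (forall k, C k -> C' k) ->
  psubset (coord_subspace C) (coord_subspace C').
Proof.
move=> sCC' L CL v vL k C'k; apply: (CL v) => //; apply: contra C'k; exact: sCC'.
Qed.

Lemma coord_subspace_sep C C' k : C' k -> ~~ C k ->
  ~ psubset (coord_subspace C') (coord_subspace C).
Proof.
move=> C'k Ck sub; have [L /sub CL EL] := coord_subspace_delta C'k.
have := CL (delta_mx 0 k); rewrite EL memv_line => /(_ isT k Ck)/eqP.
by rewrite mxE !eqxx oner_eq0.
Qed.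

End CoordinateSubspace.

(** * The resultant variety *)

Section Resultant.
Variables (K : closedFieldType) (n d : nat).
Hypotheses (n_gt1 : (1 < n)%N) (d_gt0 : (0 < d)%N).

Let n_gt0 : (0 < n)%N := ltnW n_gt1.
Let i0 : 'I_n := Ordinal n_gt0.
Let i1 : 'I_n := Ordinal n_gt1.

Local Notation N := (n * d.+1).-1.
Local Notation S := {mpoly K[N.+1]}.
Local Notation B := {poly {mpoly K[n * d]}}.
Local Notation X := (resultant_variety K d n).
Local Notation e := (d.-1 + d.-1)%N.

(** * Coordinates and the parametrisation by a common root and quotients *)

Lemma ncoordE : N.+1 = (n * d.+1)%N.
Proof. by rewrite prednK // muln_gt0 n_gt0. Qed.

(* The coefficients [c_j] of [(x - t) (q_0 x^(d-1) + ... + q_(d-1))], for [q_d = 0]. *)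
Definition mul_root (A : comNzRingType) (t : A) (q : nat -> nat -> A) (i j : nat) : A :=
  q i j - t * (if j is j'.+1 then q i j' else 0).

Lemma mul_root_gt0 (A : comNzRingType) (t : A) q i j : (0 < j)%N ->
  mul_root t q i j = q i j - t * q i j.-1.
Proof. by case: j. Qed.

Definition at_coord (T : Type) (c : nat -> nat -> T) (k : nat) : T :=
  c (k %/ d.+1)%N (k %% d.+1)%N.

Definition idx (i j : nat) : 'I_N.+1 := inord (i * d.+1 + j).

Lemma idxE i j : (i < n)%N -> (j <= d)%N -> idx i j = (i * d.+1 + j)%N :> nat.
Proof.
by move=> lti lej; rewrite inordK // ncoordE; nia.
Qed.

Lemma coord_idx T (c : nat -> nat -> T) i j :
  (i < n)%N -> (j <= d)%N -> at_coord c (idx i j) = c i j.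
Proof.
move=> lti lej; rewrite /at_coord idxE // divnMDl // modnMDl.
by rewrite divn_small ?addn0 // modn_small.
Qed.

Lemma idx_surj (k : 'I_N.+1) : exists i j, [/\ (i < n)%N, (j <= d)%N & k = idx i j].
Proof.
exists (k %/ d.+1)%N, (k %% d.+1)%N.
have lti : (k %/ d.+1 < n)%N by rewrite ltn_divLR //; have := ltn_ord k; rewrite {2}ncoordE.
have lej : (k %% d.+1 <= d)%N by rewrite -ltnS ltn_mod.
by split=> //; apply: val_inj; rewrite /= idxE // -divn_eq.
Qed.

(* The variable [q_{i,j}], extended by [0] for [j >= d]. *)
Definition qvar (i j : nat) : {mpoly K[n * d]} :=
  if (j < d)%N then (if insub (i * d + j)%N is Some k then 'X_k else 0) else 0.

(** The outer variable ['X] is t, so the size bounds the degree in t, and [eval2] specialises t and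
    the q_{i,j} together. *)
Definition Psi : S -> B :=
  mmap (polyC \o mpolyC (n * d) (R := K))
    (fun k => at_coord (mul_root 'X (fun i j => (qvar i j)%:P)) k).

HB.instance Definition _ := GRing.RMorphism.on Psi.

(** The substitution of [Psi] with an arbitrary target: it serves over K[a][x], with t = x, and over
    K. *)
Definition subst_mul_root (A : comNzRingType) (f : K -> A) (t : A) (q : nat -> nat -> A) : S -> A :=
  mmap f (fun k => at_coord (mul_root t q) k).

Lemma eval2_Psi (A : comNzRingType) (g : {rmorphism {mpoly K[n * d]} -> A}) y p :
  eval2 g y (Psi p) = subst_mul_root (g \o mpolyC (n * d) (R := K)) y (fun i j => g (qvar i j)) p.
Proof.
rewrite /Psi mmap_comp; apply: eq_mmap => [c|k] /=; first by rewrite eval2C.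
rewrite /at_coord /mul_root rmorphB rmorphM /= eval2C eval2X.
by case: (k %% d.+1)%N => [|j]; rewrite ?rmorph0 // eval2C.
Qed.

Lemma Psi_indet (i : 'I_n) (j : 'I_d.+1) :
  Psi (indet K i j) = mul_root 'X (fun i j => (qvar i j)%:P) i j.
Proof.
by rewrite /Psi /indet mmapX mmap1U -/(idx i j) coord_idx // -ltnS.
Qed.

Lemma qvar_ge i j : (d <= j)%N -> qvar i j = 0.
Proof. by rewrite /qvar ltnNge => ->. Qed.

(** The sum telescopes: up to index [m] it equals [q i m * t ^+ (d - m)], and [q i d] is 0. *)
Lemma mul_root_horner (A : comNzRingType) (t : A) q i : (forall j, (d <= j)%N -> q i j = 0) ->
  \sum_(j < d.+1) mul_root t q i j * t ^+ (d - j) = 0.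
Proof.
move=> q0.
have H m : (m <= d)%N -> \sum_(j < m.+1) mul_root t q i j * t ^+ (d - j) = q i m * t ^+ (d - m).
  elim: m => [|m IH] le; first by rewrite big_ord1 /mul_root mulr0 subr0.
  rewrite big_ord_recr /= IH; last exact: ltnW.
  rewrite /mul_root -(subnSK le) exprS; ring.
by rewrite H // q0 // mul0r.
Qed.

Lemma Psi_generic_poly_root (i : 'I_n) : (map_poly Psi (generic_poly K d i)).['X] = 0.
Proof.
rewrite /generic_poly rmorph_sum /= horner_sum.
rewrite -[RHS](@mul_root_horner _ 'X (fun i j => (qvar i j)%:P) i); last first.
  by move=> j /qvar_ge ->.
apply: eq_bigr => j _; rewrite rmorphM /= map_polyC map_polyXn hornerM hornerC hornerXn.
by rewrite -Psi_indet.
Qed.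

Lemma resultant_ideal_Psi p : resultant_ideal p -> Psi p = 0.
Proof.
move=> [h E]; rewrite -[Psi p](hornerC _ 'X) -map_polyC E rmorph_sum horner_sum big1 // => i _.
by rewrite rmorphM /= hornerM Psi_generic_poly_root mulr0.
Qed.

(* Dividing [f_i] by [x - t] in [K[a][x]] with [t = x] has remainder [f_i(x)];
   hence the substitution of [x] for [t] and of the quotient for [q] only
   changes [a_{i,d}] into [a_{i,d} - f_i]. *)
Definition horner_quotient (i j : nat) : {poly S} :=
  if (j < d)%N then \sum_(k < j.+1) ('X_(idx i k))%:P * 'X^(j - k) else 0.

Definition in_generic_ideal (u : {poly S}) : Prop :=
  exists h : 'I_n -> {poly S}, u = \sum_(i < n) h i * generic_poly K d i.

Lemma in_generic_idealD u v :
  in_generic_ideal u -> in_generic_ideal v -> in_generic_ideal (u + v).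
Proof.
move=> [h ->] [k ->]; exists (fun i => h i + k i).
by rewrite -big_split; apply: eq_bigr => i _; rewrite mulrDl.
Qed.

Lemma in_generic_idealM u v : in_generic_ideal u -> in_generic_ideal (v * u).
Proof.
move=> [h ->]; exists (fun i => v * h i).
by rewrite mulr_sumr; apply: eq_bigr => i _; rewrite mulrA.
Qed.

Lemma in_generic_ideal0 : in_generic_ideal 0.
Proof. by exists (fun _ => 0); rewrite big1 // => i _; rewrite mul0r. Qed.

Lemma subst_horner_quotient_var (k : 'I_N.+1) :
  in_generic_ideal (('X_k)%:P - at_coord (mul_root 'X horner_quotient) k).
Proof.
have [i [j [lti lej ->]]] := idx_surj k; rewrite coord_idx //.
have HS e : (0 < e <= d)%N -> \sum_(k < e.+1) ('X_(idx i k))%:P * 'X^(e - k) =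
    'X * horner_quotient i e.-1 + ('X_(idx i e))%:P.
  case: e => // e /= lt; rewrite /horner_quotient lt big_ord_recr /= subnn expr0 mulr1.
  congr (_ + _); rewrite mulr_sumr; apply: eq_bigr => l _.
  by rewrite mulrCA -exprS subSn // -ltnS.
have [ltjd|gejd] := ltnP j d.
  suff -> : mul_root 'X horner_quotient i j = ('X_(idx i j))%:P.
    by rewrite subrr; apply: in_generic_ideal0.
  have [j0|jgt0] := posnP j.
    by rewrite j0 /mul_root mulr0 subr0 /horner_quotient d_gt0 big_ord1 subnn expr0 mulr1.
  by rewrite mul_root_gt0 // {1}/horner_quotient ltjd HS ?jgt0 // addrC addKr.
have jd : j = d by apply/eqP; rewrite eqn_leq lej.
(* For [j = d] the difference is a_{i,d} plus x times the last quotient coefficient, that is f_i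
   itself; so the cofactor of f_i is 1 and the others are 0. *)
exists (fun i' => (i' == Ordinal lti)%:R).
rewrite (bigD1 (Ordinal lti)) //= eqxx mul1r big1 ?addr0; last first.
  by move=> i' /negPf ->; rewrite mul0r.
rewrite mul_root_gt0 ?jd // {1}/horner_quotient ltnn sub0r opprK.
by rewrite addrC -HS ?d_gt0 ?leqnn.
Qed.

(** Two ring morphisms that agree on the variables modulo an ideal agree modulo it everywhere; this
    is carried from variables to powers, monomials and sums. *)
Lemma subst_horner_quotient p : in_generic_ideal
  (p%:P - subst_mul_root (polyC \o mpolyC N.+1 (R := K)) 'X horner_quotient p).
Proof.
rewrite [in p%:P](mpolyE p) rmorph_sum /= /subst_mul_root /mmap -sumrB.
elim/big_rec: _ => [|a w _ Iw]; first exact: in_generic_ideal0.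
apply: in_generic_idealD => //; rewrite -mul_mpolyC polyCM -mulrBr.
apply: in_generic_idealM; rewrite mpolyXE_id rmorph_prod /mmap1.
elim/big_rec2: _ => [|k u v _ IH]; first by rewrite subrr; apply: in_generic_ideal0.
rewrite rmorphXn /=; set x := ('X_k)%:P; set y := at_coord _ _.
have IHk m : in_generic_ideal (x ^+ m - y ^+ m).
  elim: m => [|m IHm]; first by rewrite subrr; apply: in_generic_ideal0.
  have -> : x ^+ m.+1 - y ^+ m.+1 = x ^+ m * (x - y) + y * (x ^+ m - y ^+ m).
    by rewrite !exprS; ring.
  apply: in_generic_idealD; apply: in_generic_idealM => //.
  exact: subst_horner_quotient_var.
have -> : x ^+ a k * v - y ^+ a k * u = x ^+ a k * (v - u) + u * (x ^+ a k - y ^+ a k) by ring.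
by apply: in_generic_idealD; apply: in_generic_idealM.
Qed.

(** If [Psi p] is 0, so is its specialisation at t = x and at the Horner quotients; but that is
    congruent to [p] modulo the f_i. *)
Lemma resultant_idealE p : resultant_ideal p <-> Psi p = 0.
Proof.
split=> [|p0]; first exact: resultant_ideal_Psi.
pose w (k : 'I_(n * d)) : {poly S} := horner_quotient (k %/ d) (k %% d).
pose g : {rmorphism {mpoly K[n * d]} -> {poly S}} := mmap (polyC \o mpolyC N.+1 (R := K)) w.
have := subst_horner_quotient p; set u := subst_mul_root _ _ _ _.
suff -> : u = 0 by rewrite subr0.
have -> : 0 = eval2 g 'X (Psi p) by rewrite p0 rmorph0.
rewrite eval2_Psi; apply: eq_mmap => [c|k] /=.
  by rewrite mmapC.
suff E i j : (i < n)%N -> g (qvar i j) = horner_quotient i j.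
  have [i [j [lti lej ->]]] := idx_surj k; rewrite !coord_idx // /mul_root.
  by case: j lej => [|j] lej; rewrite -!E.
move=> lti; rewrite /qvar; case: ltnP => [ltj|gej]; last first.
  by rewrite rmorph0 /horner_quotient ltnNge gej.
case: insubP => [k' _ Ek|]; last by case/negP; nia.
rewrite /= mmapX mmap1U /w Ek divnMDl // modnMDl.
by rewrite divn_small ?addn0 // modn_small.
Qed.

(** * Points of the variety and its vanishing ideal *)

(** Coefficients of [n] polynomials with the common root [x]. The root at infinity is left out: the
    affine roots already determine the vanishing ideal. *)
Definition point (x : K) (v : 'I_(n * d) -> K) : 'rV[K]_N.+1 :=
  \row_k at_coord (mul_root x (fun i j => (qvar i j).@[v])) k.

Lemma meval_point x v p : p.@[point x v 0] = eval2 (meval v) x (Psi p).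
Proof.
rewrite eval2_Psi; apply: eq_mmap => [c|k] /=; first by rewrite mevalC.
by rewrite mxE.
Qed.

Lemma point_idx x v i j : (i < n)%N -> (j <= d)%N ->
  point x v 0 (idx i j) = mul_root x (fun i j => (qvar i j).@[v]) i j.
Proof. by move=> lti lej; rewrite mxE coord_idx. Qed.

Lemma qvar_scale v a i j : (qvar i j).@[fun k => a * v k] = a * (qvar i j).@[v].
Proof.
rewrite /qvar; case: ifP => _; last by rewrite !meval0 mulr0.
by case: insub => [k|]; rewrite ?mevalXU // !meval0 mulr0.
Qed.

Lemma qvar_row (w : nat -> nat -> K) i j : (i < n)%N -> (j < d)%N ->
  (qvar i j).@[fun k : 'I_(n * d) => w (k %/ d)%N (k %% d)%N] = w i j.
Proof.
move=> lti ltj; rewrite /qvar ltj; case: insubP => [k _ Ek|]; last by case/negP; nia.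
by rewrite mevalXU Ek divnMDl // modnMDl divn_small // addn0 modn_small.
Qed.

Lemma point_scale x v a : a *: point x v = point x (fun k => a * v k).
Proof.
apply/rowP => k; rewrite !mxE /at_coord /mul_root qvar_scale mulrBr mulrCA.
by case: (k %% d.+1)%N => [|j]; rewrite ?mulr0 // qvar_scale.
Qed.

Lemma resultant_variety_point x v (L : proj_space K N) :
  val L = <[point x v]>%VS -> X L.
Proof.
move=> EL p /resultant_idealE p0 u; rewrite EL => /vlineP[a ->].
by rewrite point_scale meval_point p0 rmorph0.
Qed.

Lemma resultant_variety_nonempty : exists L, X L.
Proof.
have [|L EL] := @proj_space_line K N (point 0 (fun _ => 1)).
  apply/eqP => /rowP/(_ (idx 0 0)); rewrite point_idx // mxE /mul_root mulr0 subr0.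
  by rewrite (qvar_row (fun _ _ => 1)) // => /eqP; rewrite oner_eq0.
by exists L; apply: resultant_variety_point EL.
Qed.

(** When [Psi p] is nonzero, first the q_{i,j} and then t can be chosen in K with nonzero value;
    this is a point of the parametrisation where [p] does not vanish. *)
Lemma vanishing_resultantE p : vanishing_ideal X p <-> Psi p = 0.
Proof.
split=> [Ip|p0 L XL]; last by apply: XL; apply/resultant_idealE.
apply/eqP/negPn/negP; rewrite -lead_coef_eq0 => /mpoly_exists_nonroot[v].
move=> /(@poly_exists_nonroot K _ (meval v) (Psi p))[x].
(* If the chosen vector is zero it spans no point, but it lies on every line of the nonempty
   variety. *)
rewrite -meval_point; have [->|nz] := eqVneq (point x v) 0.
  have [L XL] := resultant_variety_nonempty.
  by rewrite (Ip L XL) ?eqxx // mem0v.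
have [L EL] := proj_space_line nz.
by rewrite (Ip L) ?eqxx //; [exact: resultant_variety_point EL|rewrite EL memv_line].
Qed.

Lemma resultant_variety_irreducible : irreducible X.
Proof.
apply: irreducible_of_prime => [|p q]; first exact: resultant_variety_nonempty.
rewrite !vanishing_resultantE rmorphM => /eqP; rewrite mulf_eq0.
by case/orP => /eqP; [left|right].
Qed.

(** * Bidegrees and homogeneity of the kernel *)

Definition bihomogeneous m (u : B) : Prop :=
  (size u <= m.+1)%N /\ forall j, u`_j \is m.-homog.

Lemma bihomogeneousM m1 m2 u v :
  bihomogeneous m1 u -> bihomogeneous m2 v -> bihomogeneous (m1 + m2) (u * v).
Proof.
move=> [szu hu] [szv hv]; split.
  by apply: leq_trans (size_polyMleq _ _) _; rewrite -ltnS; lia.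
by move=> j; rewrite coefM; apply: rpred_sum => i _; apply: dhomogM.
Qed.

Lemma bihomogeneous1 : bihomogeneous 0 1.
Proof.
split=> [|j]; first by rewrite size_poly1.
rewrite coefC; case: eqP => _; [exact: dhomog1 | exact: dhomog0].
Qed.

Lemma qvar_homog i j : qvar i j \is 1.-homog.
Proof.
rewrite /qvar; case: ifP => _; last exact: dhomog0.
by case: insub => [k|]; [rewrite dhomogX /= mdeg1 | exact: dhomog0].
Qed.

Lemma bihomogeneous_Psi_var k : bihomogeneous 1 (Psi 'X_k).
Proof.
rewrite /Psi mmapX mmap1U /at_coord /mul_root.
set b := if _ is j.+1 then _ else _.
have [c hc ->] : exists2 c, c \is 1.-homog & b = c%:P.
  rewrite /b; case: (k %% d.+1)%N => [|j]; first by exists 0; rewrite ?dhomog0.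
  by exists (qvar (k %/ d.+1)%N j); rewrite ?qvar_homog.
split.
  apply: leq_trans (size_polyD _ _) _; rewrite size_polyN geq_max.
  rewrite (leq_trans (size_polyC_leq1 _)) //= mulrC.
  by rewrite (leq_trans (size_polyMleq _ _)) // size_polyX addn2 /= ltnS size_polyC_leq1.
move=> j; rewrite coefB coefXM; apply: rpredB; last case: j => [|j].
- by rewrite coefC; case: eqP => _; [exact: qvar_homog | exact: dhomog0].
- exact: dhomog0.
by rewrite /= coefC; case: eqP => _; [exact: hc | exact: dhomog0].
Qed.

Lemma bihomogeneous_Psi m p : p \is m.-homog -> bihomogeneous m (Psi p).
Proof.
move=> hp; rewrite (mpolyE p) rmorph_sum /= big_seq.
elim/big_rec: _ => [|a u ap [szu hu]]; first by split=> [|j]; rewrite ?size_poly0 // coef0 dhomog0.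
have [sza ha] : bihomogeneous m (Psi 'X_[a]).
  have <- : mdeg a = m := dhomog_mf hp ap.
  rewrite mpolyXE_id rmorph_prod mdegE /=.
  elim/big_rec2: _ => [|k v l _ IH]; first exact: bihomogeneous1.
  apply: bihomogeneousM => //; rewrite rmorphXn /=.
  elim: (a k) => [|e IHe]; first exact: bihomogeneous1.
  by rewrite exprS -add1n; apply: bihomogeneousM => //; exact: bihomogeneous_Psi_var.
rewrite -mul_mpolyC rmorphM /= [Psi _%:MP]mmapC /= mul_polyC; split.
  apply: leq_trans (size_polyD _ _) _; rewrite geq_max szu andbT.
  by apply: leq_trans (size_scale_leq _ _) _.
by move=> j; rewrite coefD rpredD // coefZ mul_mpolyC rpredZ.
Qed.

(** [Psi] preserves the degree, counted in q, so the degree [m] component of [p] alone produces the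
    degree [m] part of [Psi p]. Hence the forms in the kernel suffice to define the variety. *)
Lemma Psi_pihomog p m : Psi p = 0 -> Psi (pihomog mdeg m p) = 0.
Proof.
move=> p0; have [lt|ge] := ltnP m (msize p); last first.
  suff -> : pihomog mdeg m p = 0 by rewrite rmorph0.
  rewrite pihomogE big_seq_cond big1 // => a /andP[ap /eqP Ea].
  by have := msize_mdeg_lt ap; rewrite Ea ltnNge ge.
apply/polyP => j; rewrite coef0.
have := congr1 (fun u : B => pihomog mdeg m u`_j) p0.
rewrite coef0 pihomog0 [in Psi p](pihomog_partitionE (leqnn (msize p))).
rewrite rmorph_sum coef_sum raddf_sum /= (bigD1 (Ordinal lt)) //= big1 ?addr0 => [|i ne].
  have [_ h] := bihomogeneous_Psi (pihomogP mdeg m p).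
  by rewrite pihomog_dE.
have [_ h] := bihomogeneous_Psi (pihomogP mdeg i p).
by rewrite (pihomog_ne0 _ (h j)).
Qed.

Lemma resultant_variety_closed : zariski_closed X.
Proof.
exists (fun p => (exists m, p \is m.-homog) /\ Psi p = 0); split=> [p []//|L].
split=> [XL p [_ p0]|XL p]; first by apply: XL; apply/resultant_idealE.
move=> /resultant_idealE p0 v vL.
rewrite [p](pihomog_partitionE (leqnn (msize p))) raddf_sum big1 // => i _.
apply: XL vL; split; last exact: Psi_pihomog.
by exists i; exact: pihomogP.
Qed.

(** * Upper bound for the Hilbert function *)

(** The pair [(j, a)] stands for t^j q^a. *)
Definition bimonomials m k : seq (nat * 'X_{1..n * d}) :=
  [seq (j, a) | j <- iota 0 m, a <- monomials (n * d) k].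

Lemma size_bimonomials r m k : (n * d = r.+1)%N ->
  size (bimonomials m k) = (m * 'C(k + r, r))%N.
Proof.
move=> E; rewrite size_allpairs size_iota.
have -> : size (monomials (n * d) k) = 'C(k + r, k) by rewrite E size_monomials.
by rewrite -[in LHS]bin_sub ?leq_addr // addKn.
Qed.

Lemma mem_bimonomials m k j a :
  ((j, a) \in bimonomials m k) = (j < m)%N && (mdeg a == k).
Proof.
apply/allpairsP/andP => [[[j' a'] /= [jm ak [-> ->]]]|[jm ak]].
  by move: jm ak; rewrite mem_iota mem_monomials.
by exists (j, a); rewrite /= mem_iota mem_monomials.
Qed.

Lemma bimonomials_uniq m k : uniq (bimonomials m k).
Proof.
apply: allpairs_uniq; rewrite ?iota_uniq ?monomials_uniq //.
by move=> [a b] [a' b'] _ _ [-> ->].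
Qed.

(** Forms independent modulo the kernel of [Psi] have images with independent coefficient rows, and
    the columns are the monomials that the bidegree allows. *)
Lemma hilbert_resultant_le r m h : (n * d = r.+1)%N ->
  hilbert_value X m h -> (h <= m.+1 * 'C(m + r, r))%N.
Proof.
move=> E /hilbert_value_independent[s [<- hs ind]].
rewrite -(size_bimonomials _ _ E); set L := bimonomials _ _.
pose A := \matrix_(i < size s, l < size L)
   ((Psi s`_i)`_(nth (0%N, 0%MM) L l).1)@_(nth (0%N, 0%MM) L l).2.
suff /eqP <- : row_free A by exact: rank_leq_col.
rewrite -kermx_eq0; apply/rowV0P => v /sub_kermxP vA; apply/rowP => i; rewrite mxE.
pose c k := if insub k is Some k' then v 0 k' else 0.
have cE (k : 'I_(size s)) : c k = v 0 k by rewrite /c valK.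
rewrite -cE; apply: ind => //; apply/vanishing_resultantE.
set p := \sum_(_ < _) _; have hp : p \is m.-homog.
  by apply: rpred_sum => k _; apply: rpredZ; apply: hs; apply: mem_nth.
have [szp hPp] := bihomogeneous_Psi hp.
apply/polyP => j; apply/mpolyP => a; rewrite coef0 mcoeff0.
have [jm|jm] := ltnP j m.+1; last by rewrite nth_default ?mcoeff0 // (leq_trans szp).
have [am|am] := eqVneq (mdeg a) m; last by apply: dhomog_nemf_coeff (hPp j) am.
have jaL : (j, a) \in L by rewrite mem_bimonomials jm am eqxx.
have lt : (index (j, a) L < size L)%N by rewrite index_mem.
have /rowP/(_ (Ordinal lt)) := vA; rewrite !mxE => sum0; rewrite -[RHS]sum0.
rewrite /p rmorph_sum coef_sum raddf_sum; apply: eq_bigr => k _.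
rewrite mxE /= nth_index //= -cE -mul_mpolyC rmorphM /= [Psi _%:MP]mmapC /=.
by rewrite mul_polyC coefZ mul_mpolyC mcoeffZ.
Qed.

(** * The common root as a fraction from the Sylvester matrix *)

(** The 2d - 1 rows x^r f_2 for r < d - 1, then x^r f_1 for r < d; the row x^(d-1) f_2 is the one
    removed. In this order f_1 = x^d and f_2 = x give the rows x, x^2, ..., x^(2d-1). *)
Definition sylvester_poly (r : nat) : {poly S} :=
  if (r < d.-1)%N then 'X^r * generic_poly K d i1 else 'X^(r - d.-1) * generic_poly K d i0.

Lemma size_generic_poly (i : 'I_n) : (size (generic_poly K d i) <= d.+1)%N.
Proof.
apply: leq_trans (size_sum _ _ _) _; apply/bigmax_leqP => j _.
rewrite mul_polyC (leq_trans (size_scale_leq _ _)) // size_polyXn ltnS.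
exact: leq_subr.
Qed.

Lemma size_sylvester_poly r : (r <= e)%N -> (size (sylvester_poly r) <= e.+2)%N.
Proof.
move=> ler; rewrite /sylvester_poly; case: ifP => ltr;
  rewrite (leq_trans (size_polyMleq _ _)) // size_polyXn.
  by have := size_generic_poly i1; lia.
by have := size_generic_poly i0; lia.
Qed.

Lemma sylvester_poly_homog r c : (sylvester_poly r)`_c \is 1.-homog.
Proof.
have hg (i : 'I_n) c' : (generic_poly K d i)`_c' \is 1.-homog.
  rewrite /generic_poly coef_sum; apply: rpred_sum => j _.
  rewrite coefCM coefXn mulr_natr; case: eqP => _; last exact: dhomog0.
  by rewrite dhomogX /= mdeg1.
by rewrite /sylvester_poly; case: ifP => _; rewrite coefXnM; case: ifP => _ //; exact: dhomog0.
Qed.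

(* The columns are indexed by the exponents [1, ..., 2d - 1]; the column of exponent
   [0] is split off. A common root [t] then gives [sylvester *m (t^(c+1))_c = - sylvester_col0],
   which Cramer's rule solves for [t]. *)
Definition sylvester : 'M[S]_e.+1 := \matrix_(r, c) (sylvester_poly r)`_c.+1.
Definition sylvester_col0 : 'cV[S]_e.+1 := \col_r (sylvester_poly r)`_0.
Definition root_den : S := \det sylvester.
Definition root_num : S := - (\adj sylvester *m sylvester_col0) 0 0.

Lemma root_den_homog : root_den \is (e.+1).-homog.
Proof. by apply: homog_det => i j; rewrite mxE; apply: sylvester_poly_homog. Qed.

Lemma root_num_homog : root_num \is (e.+1).-homog.
Proof.
rewrite /root_num mxE dhomogN; apply: rpred_sum => k _.
suff : (\adj sylvester) 0 k * sylvester_col0 k 0 \is (e + 1).-homog by rewrite addn1.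
apply: dhomogM; last by rewrite mxE; apply: sylvester_poly_homog.
rewrite mxE /cofactor rpredMsign; apply: homog_det => i j.
by rewrite !mxE; apply: sylvester_poly_homog.
Qed.

Lemma Psi_sylvester_poly_root r : (map_poly Psi (sylvester_poly r)).['X] = 0.
Proof.
by rewrite /sylvester_poly; case: ifP => _;
  rewrite rmorphM hornerM [X in _ * X]Psi_generic_poly_root ?mulr0.
Qed.

Lemma Psi_root_num : Psi root_num = 'X * Psi root_den.
Proof.
pose A := map_mx Psi sylvester; pose v := map_mx Psi sylvester_col0.
pose x : 'cV[B]_e.+1 := \col_c 'X^(c.+1).
have Ax : A *m x = - v.
  apply/colP => r; rewrite !mxE; apply/eqP; rewrite -subr_eq0 opprK; apply/eqP.
  rewrite -[RHS](Psi_sylvester_poly_root r).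
  have sz : (size (map_poly Psi (sylvester_poly r)) <= e.+2)%N.
    apply: leq_trans (size_poly _ _) _; apply: size_sylvester_poly.
    by rewrite -ltnS.
  rewrite (horner_coef_wide _ sz) [RHS]big_ord_recl [RHS]addrC coef_map expr0 mulr1.
  by congr (_ + _); apply: eq_bigr => c _; rewrite !mxE coef_map.
(* Entry 0 of [x] is t itself, so entry 0 of [\adj A *m (A *m x)] is t times the determinant. *)
have := congr1 (fun u => (\adj A *m u) 0 0) Ax.
rewrite mulmxA mul_adj_mx mul_scalar_mx mxE mxE mulmxN mxE.
rewrite -map_mx_adj -map_mxM mxE -rmorphN det_map_mx mulrC => ->.
by rewrite -/root_num.
Qed.

(** At t = 0 with f_1 = x^d and f_2 = x the Sylvester matrix without column 0 is the identity. *)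
Lemma Psi_root_den_neq0 : Psi root_den != 0.
Proof.
pose w (i j : nat) : K := if i == 0%N then (j == 0%N)%:R else (j == d.-1)%:R.
pose q (k : 'I_(n * d)) := w (k %/ d)%N (k %% d)%N.
suff : root_den.@[point 0 q 0] != 0.
  by rewrite meval_point; apply: contra => /eqP ->; rewrite rmorph0.
set pt := point 0 q.
suff : map_mx (meval (pt 0)) sylvester = 1%:M.
  by move=> E; rewrite -[_.@[_]]/(meval _ _) -det_map_mx E det1 oner_neq0.
have ptE (i : 'I_n) (j : 'I_d.+1) : (indet K i j).@[pt 0] = if (j < d)%N then w i j else 0.
  rewrite mevalXU point_idx //; last by rewrite -ltnS.
  rewrite /mul_root mul0r subr0.
  case: ltnP => [ltj|gej]; first by rewrite qvar_row.
  by rewrite qvar_ge // meval0.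
have fE (i : 'I_n) : map_poly (meval (pt 0)) (generic_poly K d i) =
    \sum_(j < d) (w i j)%:P * 'X^(d - j).
  rewrite /generic_poly rmorph_sum big_ord_recr /= [X in _ + X]rmorphM /= map_polyC /=.
  rewrite ptE ltnn mul0r addr0.
  by apply: eq_bigr => j _; rewrite rmorphM /= map_polyC map_polyXn /= ptE /= ltn_ord.
have f0 : map_poly (meval (pt 0)) (generic_poly K d i0) = 'X^d.
  rewrite fE (bigD1 (Ordinal d_gt0)) //= /w eqxx mul1r subn0 big1 ?addr0 // => j.
  by rewrite -val_eqE /= => /negPf ->; rewrite mul0r.
have ltd1 : (d.-1 < d)%N by rewrite prednK.
have f1 : map_poly (meval (pt 0)) (generic_poly K d i1) = 'X.
  rewrite fE (bigD1 (Ordinal ltd1)) //= /w eqxx mul1r big1 ?addr0 => [|j].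
    by have -> : (d - d.-1 = 1)%N by lia.
  by rewrite -val_eqE /= => /negPf ->; rewrite mul0r.
apply/matrixP => r c; rewrite !mxE -coef_map /=.
have -> : map_poly (meval (pt 0)) (sylvester_poly r) = 'X^(r.+1).
  rewrite /sylvester_poly; case: ltnP => ler; rewrite rmorphM.
    by rewrite [X in _ * X]f1 [X in X * _]map_polyXn exprSr.
  by rewrite [X in _ * X]f0 [X in X * _]map_polyXn -exprD; congr 'X^_; lia.
by rewrite coefXn eqSS eq_sym.
Qed.

(** * Lower bound for the Hilbert function *)

(** Fewer than [d] powers of t suffice as coefficients; multiplication by [Psi root_den ^+ d.-1]
    clears all of them at once. *)
Definition root_span k (g : B) : Prop :=
  exists2 p : 'I_d -> S, (forall a, p a \is k.-homog) & g = \sum_(a < d) 'X^a * Psi (p a).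

Lemma root_span0 k : root_span k 0.
Proof.
exists (fun _ => 0) => [a|]; first exact: dhomog0.
by rewrite big1 // => a _; rewrite rmorph0 mulr0.
Qed.

Lemma root_spanB k g h : root_span k g -> root_span k h -> root_span k (g - h).
Proof.
move=> [p hp ->] [q hq ->]; exists (fun a => p a - q a) => [a|]; first exact: rpredB.
by rewrite -sumrB; apply: eq_bigr => a _; rewrite rmorphB mulrBr.
Qed.

Lemma root_spanD k g h : root_span k g -> root_span k h -> root_span k (g + h).
Proof.
move=> Sg Sh; rewrite -[h]opprK -[- h]sub0r; apply: root_spanB => //.
by apply: root_spanB => //; apply: root_span0.
Qed.

Lemma root_spanX k a p : (a < d)%N -> p \is k.-homog -> root_span k ('X^a * Psi p).
Proof.
move=> lta hp; exists (fun b => if b == Ordinal lta then p else 0) => [b|].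
  by case: eqP => _ //; exact: dhomog0.
rewrite (bigD1 (Ordinal lta)) //= eqxx big1 ?addr0 // => b /negPf ->.
by rewrite rmorph0 mulr0.
Qed.

Lemma root_spanM k l g p : root_span k g -> p \is l.-homog -> root_span (l + k) (Psi p * g).
Proof.
move=> [q hq ->] hp; exists (fun a => p * q a) => [a|]; first exact: dhomogM.
by rewrite mulr_sumr; apply: eq_bigr => a _; rewrite rmorphM mulrCA.
Qed.

(* With [A_j := Psi a_{i,j} = q_j - t q_(j-1)], either [q_j = A_j + t q_(j-1)] reduces
   [t^b q_j] to [q_0 = A_0], or [t q_j = q_(j+1) - A_(j+1)] reduces it to [q_d = 0],
   in both cases with powers of [t] below [d] as the coefficients of the [A_j]. *)
Lemma root_span_mul_qvar k g : (forall a, (a < d)%N -> root_span k ('X^a * g)) ->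
  forall i b j, (i < n)%N -> (b <= d)%N -> root_span k.+1 ('X^b * ((qvar i j)%:P * g)).
Proof.
move=> Sg i b j lti.
pose A l : B := Psi 'X_(idx i l).
have SA a l : (a < d)%N -> root_span k.+1 ('X^a * (A l * g)).
  move=> lta; rewrite mulrCA -add1n; apply: root_spanM; first exact: Sg.
  by rewrite dhomogX /= mdeg1.
have AE l : (l <= d)%N -> A l = mul_root 'X (fun i j => (qvar i j)%:P) i l.
  by move=> lel; rewrite /A /Psi mmapX mmap1U coord_idx.
have down l a : (a + l < d)%N -> root_span k.+1 ('X^a * ((qvar i l)%:P * g)).
  elim: l a => [|l IH] a lt.
    have -> : (qvar i 0)%:P = A 0%N by rewrite AE // /mul_root mulr0 subr0.
    by apply: SA; lia.
  have -> : (qvar i l.+1)%:P = A l.+1 + 'X * (qvar i l)%:P.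
    by rewrite AE ?subrK //; lia.
  rewrite mulrDl mulrDr; apply: root_spanD; first by apply: SA; lia.
  by rewrite -mulrA mulrA -exprSr; apply: IH; lia.
have up a l : (a <= d)%N -> (d <= a + l)%N -> root_span k.+1 ('X^a * ((qvar i l)%:P * g)).
  elim: a l => [|a IH] l led lt.
    by rewrite qvar_ge // mul0r mulr0; apply: root_span0.
  have [gel|ltl] := leqP d l; first by rewrite qvar_ge // mul0r mulr0; apply: root_span0.
  have -> : 'X^(a.+1) * ((qvar i l)%:P * g) =
      'X^a * ((qvar i l.+1)%:P * g) - 'X^a * (A l.+1 * g).
    by rewrite AE // exprSr /mul_root; ring.
  by apply: root_spanB; [apply: IH; lia | apply: SA; lia].
by move=> leb; have [lt|ge] := ltnP (b + j) d; [apply: down | apply: up].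
Qed.

(** Split off one variable q_{i,j} together with t^min(b, d). For c < d the rest, times t^c, has
    t-exponent below k + d again, so induction applies. *)
Lemma root_span_monomial k a b : mdeg a = k -> (b < k + d)%N ->
  root_span k ('X^b * ('X_[a])%:P).
Proof.
elim: k a b => [|k IH] a b am ltb.
  move/eqP: am; rewrite mdeg_eq0 => /eqP ->; rewrite mpolyX0 polyC1.
  by rewrite -(rmorph1 Psi); apply: root_spanX => //; exact: dhomog1.
have [l al] : exists l, a l != 0%N.
  apply/existsP; rewrite -negb_forall; apply/negP => /forallP a0.
  by move: am; rewrite mdegE big1 // => l _; apply/eqP.
have lel : (U_(l) <= a)%MM by rewrite lep1mP.
have Ea := submK lel; set a' := (a - U_(l))%MM in Ea.
have a'm : mdeg a' = k by move: am; rewrite -Ea mdegD mdeg1 addn1 => -[].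
have Xl : 'X_l = qvar (l %/ d) (l %% d).
  rewrite /qvar ltn_mod d_gt0 -divn_eq.
  by rewrite insubT //= => lt; congr 'X__; apply: val_inj.
have Eb : 'X^b = 'X^(minn b d) * 'X^(b - minn b d) :> B.
  by rewrite -exprD subnKC // geq_minl.
rewrite -Ea mpolyXD polyCM Xl Eb.
rewrite [X in root_span _ X](_ : _ = 'X^(minn b d) *
    ((qvar (l %/ d) (l %% d))%:P * ('X^(b - minn b d) * ('X_[a'])%:P))); last by ring.
apply: root_span_mul_qvar; last exact: geq_minr.
  move=> c ltc; rewrite mulrA -exprD; apply: IH => //.
  by lia.
by rewrite ltn_divLR.
Qed.

(** As t is the quotient of the images of [root_num] and [root_den], the factor t^a is absorbed by
    replacing [a] of the [d.-1] denominators by numerators. *)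
Lemma Psi_root_span k g : root_span k g ->
  exists2 p, p \is (k + d.-1 * e.+1).-homog & Psi p = Psi root_den ^+ d.-1 * g.
Proof.
move=> [p hp ->].
exists (\sum_(a < d) (root_den ^+ (d.-1 - a) * root_num ^+ a) * p a).
  apply: rpred_sum => a _; rewrite addnC; apply: dhomogM => //.
  have -> : (d.-1 * e.+1 = e.+1 * (d.-1 - a) + e.+1 * a)%N.
    by rewrite -mulnDr subnK 1?mulnC // -ltnS prednK.
  by apply: dhomogM; apply: dhomogMn; [exact: root_den_homog | exact: root_num_homog].
rewrite rmorph_sum mulr_sumr; apply: eq_bigr => a _.
rewrite rmorphM rmorphM !rmorphXn /= Psi_root_num // exprMn mulrA; congr (_ * _).
by rewrite mulrCA -exprD subnK 1?mulrC // -ltnS prednK.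
Qed.

(** Preimages of the multiples of all t^b q^a by [Psi root_den ^+ d.-1] are independent modulo the
    kernel, because this factor is nonzero in a domain. *)
Lemma hilbert_resultant_ge r k h : (n * d = r.+1)%N ->
  hilbert_value X (k + d.-1 * e.+1) h -> ((k + d) * 'C(k + r, r) <= h)%N.
Proof.
move=> E Hh; rewrite -(size_bimonomials _ _ E); set L := bimonomials _ _.
have ex (l : nat * 'X_{1..n * d}) : exists p, l \in L ->
    p \is (k + d.-1 * e.+1).-homog /\
    Psi p = Psi root_den ^+ d.-1 * ('X^(l.1) * ('X_[l.2])%:P).
  case lL : (l \in L); last by exists 0.
  move: lL; case: l => b a; rewrite mem_bimonomials => /andP[ltb /eqP am].
  by have [p hp Ep] := Psi_root_span (root_span_monomial am ltb); exists p.
pose P l := proj1_sig (constructive_indefinite_description _ (ex l)).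
have PP l : l \in L -> P l \is (k + d.-1 * e.+1).-homog /\
    Psi (P l) = Psi root_den ^+ d.-1 * ('X^(l.1) * ('X_[l.2])%:P).
  exact: (proj2_sig (constructive_indefinite_description _ (ex l))).
rewrite -(size_map P); apply: (hilbert_value_ge Hh) => [_ /mapP[l /PP[hl _] ->] //|c].
rewrite size_map => /vanishing_resultantE.
rewrite rmorph_sum /=.
pose x0 : nat * 'X_{1..n * d} := (0%N, 0%MM).
pose F (i : nat) : B := c i%N *: 'X_[(nth x0 L i).2] *: 'X^((nth x0 L i).1).
rewrite (eq_bigr (fun i : 'I_(size L) => Psi root_den ^+ d.-1 * F i)); last first.
  move=> i _; rewrite (nth_map x0) // -mul_mpolyC rmorphM /= [Psi _%:MP]mmapC /=.
  have [_ ->] := PP _ (mem_nth x0 (ltn_ord i)).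
  rewrite /F mulrCA; congr (_ * _).
  by rewrite -mul_mpolyC -mul_polyC polyCM; ring.
rewrite -mulr_sumr => /eqP; rewrite mulf_eq0 expf_eq0 (negPf Psi_root_den_neq0).
rewrite andbF /= => /eqP sum0 i lti.
set l := nth x0 L i.
have := congr1 (fun u : B => (u`_l.1)@_l.2) sum0; rewrite coef0 mcoeff0 => <-.
rewrite coef_sum raddf_sum /= (bigD1 (Ordinal lti)) //= big1 ?addr0 => [|j nij].
  by rewrite /F coefZ coefXn eqxx mulr1 mcoeffZ mcoeffX eqxx mulr1.
rewrite /F coefZ coefXn; case: eqP => [E1|_]; last by rewrite mulr0 mcoeff0.
rewrite mulr1 mcoeffZ mcoeffX; case: eqP => [E2|_]; last by rewrite mulr0.
have El : nth x0 L j = l by rewrite [RHS]surjective_pairing -E2 E1 -surjective_pairing.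
case/eqP: nij; apply: val_inj => /=; apply/eqP.
by rewrite -(nth_uniq x0 (ltn_ord j) lti (bimonomials_uniq _ _)) El.
Qed.

(* The first [m + 1] coordinates of the linear subspace [t = 0] of the variety. *)
Definition fiber_coord (m : nat) : pred 'I_N.+1 :=
  fun k => at_coord (fun i j => (j < d) && (i * d + j <= m))%N k.

Lemma fiber_coord_idx m i j : (i < n)%N -> (j <= d)%N ->
  fiber_coord m (idx i j) = ((j < d) && (i * d + j <= m))%N.
Proof. by move=> lti lej; rewrite /fiber_coord coord_idx. Qed.

(** At t = 0 the parametrisation reads a_{i,j} = q_{i,j} for j < d and a_{i,d} = 0, so the quotients
    are read off from the coordinates. *)
Lemma fiber_sub_resultant m : psubset (coord_subspace (fiber_coord m)) X.
Proof.
move=> L CL; have [v nzv EL] := proj_space_gen L.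
pose w i j := v 0 (idx i j).
apply: (@resultant_variety_point 0
  (fun k => w (k %/ d)%N (k %% d)%N)).
rewrite EL; congr (<[_]>%VS); apply/rowP => k.
have [i [j [lti lej ->]]] := idx_surj k.
rewrite point_idx // /mul_root mul0r subr0.
have [ltj|gej] := ltnP j d; first by rewrite qvar_row.
rewrite qvar_ge // meval0; apply: CL; first by rewrite EL memv_line.
by rewrite fiber_coord_idx // ltnNge gej.
Qed.

(** * Dimension and degree *)

Lemma resultant_chain_exists : exists Z, irreducible_chain X (n * d) Z.
Proof.
have nd_gt0 : (0 < n * d)%N by rewrite muln_gt0 n_gt0.
(* The member with index [n * d - 1] is the whole subspace t = 0; [X] comes on top with index
   [n * d]. *)
exists (fun m => if (m < n * d)%N then coord_subspace (fiber_coord m) else X).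
have lt_div m : (m < n * d)%N -> (m %/ d < n)%N by rewrite ltn_divLR.
split=> m lem.
  case: ifP => ltm; split.
  - exact: coord_subspace_closed.
  - apply: (@coord_subspace_irreducible _ _ _ (idx 0 0)).
    by rewrite fiber_coord_idx // d_gt0.
  - exact: fiber_sub_resultant.
  - exact: resultant_variety_closed.
  - exact: resultant_variety_irreducible.
  by [].
rewrite lem; case: ltnP => lem1.
  split.
    apply: coord_subspaceS => k; rewrite /fiber_coord /at_coord => /andP[-> le] /=.
    exact: leqW.
  apply: (@coord_subspace_sep _ _ _ _ (idx (m.+1 %/ d) (m.+1 %% d)));
    rewrite fiber_coord_idx ?lt_div ?(ltnW (ltn_pmod _ _)) // ltn_pmod //= -divn_eq //.
  by rewrite ltnn.
split; first exact: fiber_sub_resultant.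
(* With t = 1 and all q_{i,j} = 1 the coordinate a_{i,d} is -1, whereas it is 0 on the subspace t =
   0. *)
move=> sub; pose v := point 1 (fun _ => 1).
have vd : v 0 (idx 0 d) = -1.
  rewrite point_idx // mul_root_gt0 // qvar_ge // meval0 sub0r mul1r.
  by rewrite (qvar_row (fun _ _ => 1)) // prednK.
have [|L EL] := @proj_space_line K N v.
  apply/eqP => v0; move/eqP: vd; rewrite v0 mxE eq_sym oppr_eq0.
  by rewrite oner_eq0.
have /sub/(_ v) : X L by apply: resultant_variety_point EL.
rewrite EL memv_line => /(_ isT (idx 0 d)).
rewrite fiber_coord_idx // ltnn => /(_ isT)/eqP.
by rewrite vd oppr_eq0 oner_eq0.
Qed.

Lemma resultant_has_dim : has_dim X (n * d).
Proof.
split=> [|s Z chZ]; first exact: resultant_chain_exists.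
have E : (n * d = (n * d).-1.+1)%N by rewrite prednK // muln_gt0 n_gt0.
rewrite E; apply: irreducible_chain_bound chZ => m h.
exact: hilbert_resultant_le.
Qed.

Lemma resultant_has_degree : has_degree X (n * d).
Proof.
have [P HP] := hilbert_polynomial_exists X; exists (n * d)%N, P.
split=> //; first exact: resultant_has_dim.
have E : (n * d = (n * d).-1.+1)%N by rewrite prednK // muln_gt0 n_gt0.
pose h m := count (standard X) (compositions N.+1 m).
have hv m : hilbert_value X m (h m).
  by have [h' Hh] := hilbert_value_exists X m; rewrite /h -(hilbert_value_standard Hh).
have [m0 HP0] := HP.
(* The shift (d - 1)(2d - 1) is the degree of [root_den ^+ d.-1], and [d] is the surplus of powers
   of t in the lower bound. *)
apply: (@lead_coef_binomial_squeeze P h (n * d).-1 d (d.-1 * e.+1)%N _ m0 _ _ _ E).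
- by move=> m /HP0[h' Hh ->]; rewrite (hilbert_value_standard Hh).
- by move=> m; apply: hilbert_resultant_le E (hv m).
by move=> k; apply: hilbert_resultant_ge E (hv _).
Qed.

End Resultant.

Theorem corollary2 (K : closedFieldType) (n d : nat) (hn : (1 < n)%N)
    (hd : (1 < d)%N) :
  [/\ zariski_closed (resultant_variety K d n),
      irreducible (resultant_variety K d n),
      has_dim (resultant_variety K d n) (n * d) &
      has_degree (resultant_variety K d n) (n * d)].
Proof.
have n_gt0 := ltnW hn; have d_gt0 := ltnW hd.
split; first exact: resultant_variety_closed.
- exact: resultant_variety_irreducible.
- exact: resultant_has_dim.
exact: resultant_has_degree.
Qed.
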